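(* $$\lim_{p\to\infty}\frac{E^\star_{\mathrm{prod}}(p)}{\sqrt{2\log p}}=1,$$ where, for each integer $p\ge2$, $E^\star_{\mathrm{prod}}(p)=\lim_{n\to\infty}\mathbb E\,E^\star_{n,\mathrm{prod}}(p)$ is the limiting expected maximal product-state energy of the quantum $p$-spin Hamiltonian.
   Context: Pauli matrices: $\sigma^1=\begin{bmatrix}0&1\\1&0\end{bmatrix}$, $\sigma^2=\begin{bmatrix}0&-i\\ i&0\end{bmatrix}$, $\sigma^3=\begin{bmatrix}1&0\\0&-1\end{bmatrix}$, and $I_2$ is the $2\times2$ identity. For $i\in[n]=\{1,\dots,n\}$ and $a\in\{1,2,3\}$ let $\sigma^a_i=I_2^{\otimes(i-1)}\otimes\sigma^a\otimes I_2^{\otimes(n-i)}$, a matrix on $\mathbb C^{2^n}$. Let $\mathcal I^n=\{\bar{\mathbf i}=(i_1,\dots,i_p)\in[n]^p: i_1<\dots<i_p\}$ and $N_n=\binom np$, $n\ge p$. For $\bar{\mathbf i}\in\mathcal I^n$, $\bar{\mathbf a}=(a_1,\dots,a_p)\in\{1,2,3\}^p$ put $P_{\bar{\mathbf i}}^{\bar{\mathbf a}}=\prod_{j=1}^p\sigma^{a_j}_{i_j}$. The Hamiltonian is $$H_{n,p}=N_n^{-1/2}\sum_{\bar{\mathbf i}\in\mathcal I^n}\sum_{\bar{\mathbf a}\in\{1,2,3\}^p}\alpha[\bar{\mathbf i},\bar{\mathbf a}]\,P_{\bar{\mathbf i}}^{\bar{\mathbf a}},$$ where $\alpha[\bar{\mathbf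 i},\bar{\mathbf a}]$ are i.i.d. standard normal. Product states: $\mathcal S^n_{\mathrm{prod}}=\{|\phi\rangle=|\phi^{(1)}\rangle\otimes\cdots\otimes|\phi^{(n)}\rangle:\ |\phi^{(i)}\rangle\in\mathbb C^2 \text{ a unit vector for every } i\in[n]\}$, and $$E^\star_{n,\mathrm{prod}}(p)=\frac1{\sqrt n}\max_{|\phi\rangle\in\mathcal S^n_{\mathrm{prod}}}\langle\phi|H_{n,p}|\phi\rangle .$$ The limit $E^\star_{\mathrm{prod}}(p)=\lim_{n\to\infty}\mathbb E\,E^\star_{n,\mathrm{prod}}(p)$ exists for every integer $p\ge2$. *)

(* Defs.v *)
From HB Require Import structures.
From mathcomp Require Import all_boot all_order all_algebra.
From mathcomp Require Import all_classical all_reals all_analysis.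
From mathcomp Require Import complex mxtens.

Set Implicit Arguments.
Unset Strict Implicit.
Unset Printing Implicit Defensive.

Import Order.TTheory GRing.Theory Num.Theory.
Import numFieldNormedType.Exports.

Local Open Scope classical_set_scope.
Local Open Scope ring_scope.
Local Open Scope complex_scope.

Section Spins.
Variable R : realType.

(* A_0 (x) ... (x) A_(n-1), with the Kronecker product of the library; the cast
   only turns m * m ^ n into m ^ n.+1. *)
Fixpoint tensor_family (m k n : nat) :
    ('I_n -> 'M[R[i]]_(m, k)) -> 'M[R[i]]_(m ^ n, k ^ n) :=
  match n with
  | 0 => fun=> 1%:M
  | n'.+1 => fun A => castmx (esym (expnS m n'), esym (expnS k n'))
      (A ord0 *t tensor_family (fun j : 'I_n' => A (lift ord0 j)))
  end.

Definition mx22 (a b c d : R[i]) : 'M[R[i]]_2 :=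
  \matrix_(x, y) if x == 0 then (if y == 0 then a else b)
                 else (if y == 0 then c else d).

(* Indices are 0-based: pauli 0, 1, 2 are sigma^1, sigma^2, sigma^3. *)
Definition pauli (a : 'I_3) : 'M[R[i]]_2 :=
  match val a with
  | 0 => mx22 0 1 1 0
  | 1 => mx22 0 (- 'i%C) 'i%C 0
  | _ => mx22 1 0 0 (- 1)
  end.

Definition pauli_at (n : nat) (i : 'I_n) (a : 'I_3) : 'M[R[i]]_(2 ^ n) :=
  tensor_family (fun j : 'I_n => if j == i then pauli a else 1%:M).

(* The set of i_1 < ... < i_p in [n]; it has 'C(n, p) elements by
   card_ltn_sorted_tuples. *)
Definition sites (n p : nat) : finType :=
  {i : p.-tuple 'I_n | sorted ltn (map val i)}.

Definition couplings (n p : nat) : finType :=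
  (sites n p * {ffun 'I_p -> 'I_3})%type.

Definition pauli_string (n p : nat) (c : couplings n p) : 'M[R[i]]_(2 ^ n) :=
  \big[mulmx/1%:M]_(j < p) pauli_at (tnth (val c.1) j) (c.2 j).

Definition hamiltonian (n p : nat) (g : couplings n p -> R) :
    'M[R[i]]_(2 ^ n) :=
  ((Num.sqrt 'C(n, p)%:R)^-1)%:C *:
    \sum_(i : sites n p) \sum_(a : {ffun 'I_p -> 'I_3})
      (g (i, a))%:C *: pauli_string (i, a).

Definition unit_vector (m : nat) (v : 'cV[R[i]]_m) : Prop :=
  \sum_(x < m) `|v x 0| ^+ 2 = 1.

Definition product_state (n : nat) (phi : 'I_n -> 'cV[R[i]]_2) :
    'cV[R[i]]_(2 ^ n) :=
  castmx (erefl (2 ^ n)%N, exp1n n) (tensor_family phi).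

Definition product_states (n : nat) : set 'cV[R[i]]_(2 ^ n) :=
  [set product_state phi | phi in
     [set phi : 'I_n -> 'cV[R[i]]_2 | forall i, unit_vector (phi i)]].

(* <v| H |v>; it is real when H is Hermitian, and Re only changes the type. *)
Definition energy (m : nat) (H : 'M[R[i]]_m) (v : 'cV[R[i]]_m) : R :=
  complex.Re ((map_mx Num.conj v^T *m H *m v) 0 0).

(* The supremum is a maximum: the energy is continuous in the n unit vectors,
   which range over a nonempty compact set. *)
Definition max_product_energy (n p : nat) (g : couplings n p -> R) : R :=
  (Num.sqrt n%:R)^-1 *
    sup [set energy (hamiltonian g) v | v in @product_states n].

End Spins.

Section Disorder.
Context {d : measure_display} {T : measurableType d} {R : realType}.
Variable P : probability T R.

Definition mutually_independent (I : finType) (X : I -> {RV P >-> R}) : Prop :=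
  forall (J : {set I}) (B : I -> set R),
    (forall i, i \in J -> measurable (B i)) ->
    (P (\bigcap_(i in [set` J]) (X i @^-1` B i)) =
       \prod_(i in J) P (X i @^-1` B i))%E.

Definition standard_normal (X : {RV P >-> R}) : Prop :=
  forall B : set R, measurable B -> distribution P X B = normal_prob 0 1 B.

Definition iid_standard_normal (I : finType) (X : I -> {RV P >-> R}) : Prop :=
  mutually_independent X /\ forall i, standard_normal (X i).

Variable alpha : forall n p : nat, couplings n p -> {RV P >-> R}.

(* 'E_P is extended-real valued; the expectation is finite here, since the
   energy is dominated by a linear combination of the |alpha c|. *)
Definition mean_max_product_energy (n p : nat) : R :=
  fine 'E_P[fun w => max_product_energy (fun c => @alpha n p c w)]%E.

Definition limit_product_energy (p : nat) : R :=
  lim (mean_max_product_energy n p @[n --> \oo]).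

End Disorder.

(* Main.v *)
Require Import Defs.
From HB Require Import structures.
From mathcomp Require Import all_boot all_order all_algebra.
From mathcomp Require Import all_classical all_reals all_analysis.
From mathcomp Require Import measurable_realfun complex mxtens ring lra zify.
Import Order.TTheory GRing.Theory Num.Theory.
Import numFieldNormedType.Exports.
Local Open Scope classical_set_scope.
Local Open Scope ring_scope.

(** The expectation of the Hamiltonian in a product state is a polynomial in
    the Bloch vectors b_1, ..., b_n of its factors: up to the normalisation
    it is a sum of products of coordinates of p distinct b_i with independent
    standard normal coefficients (max_product_energyE). As a function of b it
    is a centred Gaussian process of variance 1 on the n-th power of the
    sphere; its covariance, the overlap of b and b', is the average over
    the p-subsets of sites of the product of the inner products of b_i and
    b'_i. The theorem says that its maximum is close to the one of
    p ^ n independent standard normal variables, sqrt(2 n ln p): a spin is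
    resolved by the process up to a distance p ^ (-1/2), and the sphere has
    room for about p spins at this distance.

    Upper bound. The energy is affine in every single Bloch vector, so its
    maximum over the sphere is at most the one over a slightly dilated net
    with the property that every linear form is at least as large somewhere on
    the dilated net as on the sphere. Projecting a grid of mesh 1 / m on the
    surface of a cube gives such a net with O(m^2) points and dilation
    1 / (1 - 1 / m^2) (net_dense, spin_energy_net), which costs a factor
    exp(O(p / m^2)). The expected maximum over the n-th power of the net is
    bounded by the Laplace transform (mean_sphere_max_ub), and m^2 of order
    p ^ (1 + delta) gives the constant (ub_asymptotics).

    Lower bound. Take as spins the points of a grid on one face of the cube,
    at distance about p ^ (-(1 - eps) / 2), with arbitrary signs. Two
    configurations that differ in a positive fraction of the sites have a
    small overlap, which is even of order n ^ (-p / 2) for most choices of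
    the signs, since the spins are then centred (sign_chaos, far_sum); the
    remaining pairs are rare (near_count). So the second moment method, with
    the exponentials truncated to energies close to the target, applies in its
    strongest form: the ratio of the second moment to the square of the first
    one is 1 + O(1 / n) for fixed p, and the maximum exceeds the
    target with probability close to 1 (mean_sphere_max_lb).

    All these estimates are pointwise inequalities between the maximal energy
    and finite combinations of exponentials of linear forms in the
    couplings, so that the only expectations ever computed are the Gaussian
    ones of gaussian_laplace. *)

Set Implicit Arguments.
Unset Strict Implicit.
Unset Printing Implicit Defensive.

(** * Product states and their Bloch vectors *)

Section TensorFamily.
Local Open Scope complex_scope.
Context {R : realType}.
Local Notation C := R[i].

Lemma castmx_mulmx (m n p m' n' p' : nat) (em : m = m') (en : n = n')
    (ep : p = p') (A : 'M[C]_(m, n)) (B : 'M[C]_(n, p)) :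
  castmx (em, en) A *m castmx (en, ep) B = castmx (em, ep) (A *m B).
Proof. by case: m' / em; case: n' / en; case: p' / ep; rewrite !castmx_id. Qed.

Lemma tensor_family_mul (m k l n : nat) (A : 'I_n -> 'M[C]_(m, k))
    (B : 'I_n -> 'M[C]_(k, l)) :
  tensor_family A *m tensor_family B = tensor_family (fun j => A j *m B j).
Proof.
elim: n A B => [|n IH] A B /=; first by rewrite mulmx1.
by rewrite castmx_mulmx tensmx_mul IH.
Qed.

Lemma tensor_family1 (m n : nat) :
  tensor_family (fun _ : 'I_n => 1%:M : 'M[C]_m) = 1%:M.
Proof.
elim: n => [|n IH] //=; rewrite IH.
have -> : (1%:M : 'M[C]_m) *t (1%:M : 'M[C]_(m ^ n)) = 1%:M.
  apply/matrixP => i j.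
  case: (mxtens_indexP i) => i0 i1; case: (mxtens_indexP j) => j0 j1.
  rewrite tensmxE !mxE -natrM mulnb (inj_eq (can_inj (@mxtens_indexK _ _))).
  by rewrite xpair_eqE.
apply/matrixP => i j; rewrite castmxE !mxE.
by rewrite (inj_eq (@cast_ord_inj _ _ _)).
Qed.

Lemma tensor_family_adjoint (m k n : nat) (A : 'I_n -> 'M[C]_(m, k)) :
  map_mx Num.conj (tensor_family A)^T =
    tensor_family (fun j => map_mx Num.conj (A j)^T).
Proof.
elim: n A => [|n IH] A /=.
  by apply/matrixP => i j; rewrite !mxE rmorph_nat eq_sym.
rewrite -IH; apply/matrixP => i j.
by rewrite castmxE !mxE castmxE !mxE rmorphM.
Qed.

Lemma tensor_family_scalar (n : nat) (A : 'I_n -> 'M[C]_1) (i j : 'I_(1 ^ n)) :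
  tensor_family A i j = \prod_(k < n) A k 0 0.
Proof.
elim: n A i j => [|n IH] A i j /=.
  have -> : i = j by rewrite (ord1 (i : 'I_1)) (ord1 (j : 'I_1)).
  by rewrite big_ord0 mxE eqxx.
rewrite castmxE mxE IH big_ord_recl; congr (_ * _).
by congr (A ord0 _ _); exact: ord1.
Qed.

Lemma tensor_family_prod (m n p : nat) (A : 'I_p -> 'I_n -> 'M[C]_m) :
  \big[mulmx/1%:M]_(j < p) tensor_family (A j) =
    tensor_family (fun k => \big[mulmx/1%:M]_(j < p) A j k).
Proof.
elim: p A => [|p IH] A.
  rewrite big_ord0 -tensor_family1; congr tensor_family.
  by apply/funext => k; rewrite big_ord0.
rewrite big_ord_recl IH tensor_family_mul; congr tensor_family.
by apply/funext => k; rewrite big_ord_recl.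
Qed.

(** Kronecker products multiply factor by factor, so the expectation of a product
    operator in a product state is a product over the sites. *)
Lemma product_state_expectation (n : nat) (phi : 'I_n -> 'cV[C]_2)
    (A : 'I_n -> 'M[C]_2) :
  (map_mx Num.conj (product_state phi)^T *m tensor_family A
     *m product_state phi) 0 0 =
  \prod_(k < n) (map_mx Num.conj (phi k)^T *m A k *m phi k) 0 0.
Proof.
have -> : map_mx Num.conj (product_state phi)^T =
    castmx (exp1n n, erefl) (map_mx Num.conj (tensor_family phi)^T).
  by apply/matrixP => i j; rewrite /product_state !(mxE, castmxE).
rewrite (tensor_family_adjoint phi) /product_state.
rewrite -[tensor_family A](castmx_id (erefl, erefl)) !castmx_mulmx.
rewrite castmxE !tensor_family_mul tensor_family_scalar.
by [].
Qed.

End TensorFamily.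

Definition site (n p : nat) (s : sites n p) (j : 'I_p) : 'I_n := tnth (val s) j.

(** Because the sites of a coupling are distinct, a Pauli string acts at most once
    on each spin and the energy is affine in each Bloch vector. *)
Lemma site_inj (n p : nat) (s : sites n p) : injective (site s).
Proof.
apply/tuple_uniqP; rewrite -(map_inj_uniq val_inj).
exact: (sorted_uniq ltn_trans ltnn (valP s)).
Qed.

Section Bloch.
Local Open Scope complex_scope.
Context {R : realType}.
Local Notation C := R[i].

Definition bloch (v : 'cV[C]_2) (a : 'I_3) : R :=
  complex.Re ((map_mx Num.conj v^T *m pauli R a *m v) 0 0).

Definition dot (x y : 'I_3 -> R) : R := \sum_(a < 3) x a * y a.

Definition unit_sphere : set ('I_3 -> R) := [set b | dot b b = 1].

Definition vec3 (x y z : R) (a : 'I_3) : R :=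
  match val a with 0 => x | 1 => y | _ => z end.

(** The energy of a product state with Bloch vectors b, see
    energy_product_state. *)
Definition spin_energy (n p : nat) (g : couplings n p -> R)
    (b : 'I_n -> 'I_3 -> R) : R :=
  (Num.sqrt 'C(n, p)%:R)^-1 *
    \sum_(c : couplings n p) g c * \prod_(j < p) b (site c.1 j) (c.2 j).

Lemma vec3P (x : 'I_3 -> R) : x = vec3 (x 0) (x 1) (x (2%:R)).
Proof.
apply/funext => a; rewrite /vec3; case: a => [[|[|[|//]]]] h /=; congr x;
  exact: val_inj.
Qed.

Lemma dotE (x1 y1 z1 x2 y2 z2 : R) :
  dot (vec3 x1 y1 z1) (vec3 x2 y2 z2) = x1 * x2 + y1 * y2 + z1 * z2.
Proof. by rewrite /dot !big_ord_recr big_ord0 /= add0r. Qed.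

Lemma mulmx2E (u : 'rV[C]_2) (a b c d : C) (v : 'cV[C]_2) :
  (u *m mx22 a b c d *m v) 0 0 =
  (u 0 0 * a + u 0 1 * c) * v 0 0 + (u 0 0 * b + u 0 1 * d) * v 1 0.
Proof.
have l1 : lift ord0 ord0 = 1 :> 'I_2 by exact: val_inj.
by rewrite !mxE !big_ord_recl !big_ord0 !mxE !big_ord_recl !big_ord0 !mxE !l1 /= !addr0.
Qed.

Lemma pauli_expectation (v : 'cV[C]_2) (a : 'I_3) :
  (map_mx Num.conj v^T *m pauli R a *m v) 0 0 = (bloch v a)%:C.
Proof.
rewrite /bloch.
case: a => [[|[|[|//]]]] h; rewrite /pauli /= mulmx2E !mxE;
case: (v 0 0) => x y; case: (v 1 0) => z w; apply/eqP; rewrite eq_complex /=;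
  apply/andP; split; apply/eqP; ring.
Qed.

Lemma blochE (x y z w : R) :
  bloch (\col_i (if i == 0 then x +i* y else z +i* w)) =
  vec3 (2 * (x * z + y * w)) (2 * (x * w - y * z)) (x^+2 + y^+2 - z^+2 - w^+2).
Proof.
apply/funext => a; rewrite /bloch /vec3 /pauli.
by case: a => [[|[|[|//]]]] h; rewrite /= mulmx2E !mxE /=; ring.
Qed.

Lemma unit_vectorE (v : 'cV[C]_2) : unit_vector v <->
  complex.Re (v 0 0) ^+ 2 + complex.Im (v 0 0) ^+ 2 +
  complex.Re (v 1 0) ^+ 2 + complex.Im (v 1 0) ^+ 2 = 1.
Proof.
rewrite /unit_vector !big_ord_recl big_ord0 addr0.
have -> : lift ord0 ord0 = 1 :> 'I_2 by exact: val_inj.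
have nE (z : C) : `|z| ^+ 2 = (complex.Re z ^+ 2 + complex.Im z ^+ 2)%:C.
  case: z => x y; rewrite normc_def /= -rmorphXn /= sqr_sqrtr //.
  by rewrite addr_ge0 // sqr_ge0.
rewrite !nE -rmorphD /= addrA.
by split => [[]|->].
Qed.

Lemma colE2 (v : 'cV[C]_2) :
  v = \col_i (if i == 0 then complex.Re (v 0 0) +i* complex.Im (v 0 0)
              else complex.Re (v 1 0) +i* complex.Im (v 1 0)).
Proof.
apply/matrixP => i j; rewrite !mxE [j]ord1.
have [->|i0] := eqVneq i 0; first by case: (v 0 0).
have -> : i = 1 by apply/val_inj; case: i i0 => [[|[|]]].
by case: (v 1 0).
Qed.

(** The squared length of the Bloch vector is the fourth power of the norm of the
    spinor. *)
Lemma bloch_unit (v : 'cV[C]_2) : unit_vector v -> unit_sphere (bloch v).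
Proof.
move=> /unit_vectorE; rewrite /unit_sphere /= [v in bloch v]colE2 blochE dotE.
move: (complex.Re (v 0 0)) (complex.Im (v 0 0)) (complex.Re (v 1 0))
  (complex.Im (v 1 0)) => x y z w h.
transitivity ((x^+2 + y^+2 + z^+2 + w^+2)^+2); last by rewrite h expr1n.
ring.
Qed.

(** The spinor (1 + z, x + i y) has, once normalised, the Bloch vector (x, y, z);
    it vanishes at the south pole, which is the Bloch vector of (0, 1). *)
Lemma bloch_surj (b : 'I_3 -> R) : unit_sphere b ->
  exists2 v : 'cV[C]_2, unit_vector v & bloch v = b.
Proof.
rewrite /unit_sphere /= [b]vec3P dotE.
move: (b 0) (b 1) (b 2%:R) => x y z h.
have [z1|z1] := eqVneq z (-1).
  exists (\col_i (if i == 0 then 0 +i* 0 else 1 +i* 0)).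
    by apply/unit_vectorE; rewrite !mxE /=; ring.
  have : x ^+ 2 + y ^+ 2 == 0 by rewrite z1 in h; apply/eqP; rewrite !expr2; lra.
  rewrite paddr_eq0 ?sqr_ge0 // !sqrf_eq0 => /andP[/eqP -> /eqP ->].
  by rewrite blochE z1; congr vec3; ring.
have z2 : 0 < 1 + z.
  have hz : z ^+ 2 <= 1 by have := sqr_ge0 x; have := sqr_ge0 y; rewrite !expr2; lra.
  rewrite lt_neqAle; apply/andP; split.
    by apply: contra_neq z1 => hz1; lra.
  by rewrite expr2 in hz; nra.
pose s := Num.sqrt (2 * (1 + z)).
have s0 : 0 < s by rewrite sqrtr_gt0; lra.
have s2 : s ^+ 2 = 2 * (1 + z) by rewrite sqr_sqrtr //; lra.
have sn : s != 0 by rewrite gt_eqF.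
exists (\col_i (if i == 0 then ((1 + z) / s) +i* 0 else (x / s) +i* (y / s))).
  apply/unit_vectorE; rewrite !mxE /= !expr_div_n s2 expr0n /=.
  have := h; rewrite -!expr2 => hh.
  have -> : x ^+ 2 = 1 - y ^+ 2 - z ^+ 2 by lra.
  by field; rewrite gt_eqF.
have e t : 2 * ((1 + z) / s * (t / s)) = t.
  transitivity (2 * (1 + z) * t / s ^+ 2); first by field.
  by rewrite s2; field; rewrite gt_eqF.
rewrite blochE !mul0r addr0 subr0 !e; congr vec3.
rewrite !expr_div_n s2 expr0n /= addr0.
have -> : x ^+ 2 = 1 - y ^+ 2 - z ^+ 2 by rewrite !expr2; lra.
by field; rewrite gt_eqF.
Qed.

End Bloch.

Section SpinEnergy.
Local Open Scope complex_scope.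
Context {R : realType}.
Local Notation C := R[i].

Let big_mulmxE (p : nat) (A : 'I_p -> 'M[C]_2) :
  \big[mulmx/1%:M]_(j < p) A j = \prod_(j < p) A j.
Proof. by []. Qed.

(** At a site of the coupling exactly one factor of the string differs from the
    identity; every other site contributes the squared norm of its spinor. *)
Lemma pauli_string_expectation (n p : nat) (c : couplings n p)
    (phi : 'I_n -> 'cV[C]_2) : (forall i, unit_vector (phi i)) ->
  (map_mx Num.conj (product_state phi)^T *m pauli_string R c
     *m product_state phi) 0 0 =
  (\prod_(j < p) bloch (phi (site c.1 j)) (c.2 j))%:C.
Proof.
move=> uphi; rewrite /pauli_string /pauli_at tensor_family_prod.
rewrite product_state_expectation.
pose S := [set site c.1 j | j in 'I_p]%SET.
rewrite (bigID (fun k => k \in S)) /= [X in _ * X]big1 ?mulr1; last first.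
  move=> k kS.
  rewrite big_mulmxE big1 ?mulmx1; last first.
    move=> j _; case: eqP => // kj.
    by case/negP: kS; apply/imsetP; exists j.
  rewrite mxE -(uphi k); apply: eq_bigr => i _.
  by rewrite !mxE normCK mulrC.
rewrite big_imset /=; last by move=> x y _ _; exact: site_inj.
rewrite rmorph_prod; apply: eq_bigr => j _ /=.
rewrite -pauli_expectation; congr ((_ *m _ *m _) 0 0).
transitivity (\prod_(i < p | i == j) pauli R (c.2 j)); last first.
  by rewrite big_pred1_eq.
rewrite big_mulmxE [RHS]big_mkcond; apply: eq_bigr => i _.
rewrite /site (inj_eq (@site_inj _ _ _)) eq_sym.
by case: eqP => // ->.
Qed.

Lemma energy_product_state (n p : nat) (g : couplings n p -> R)
    (phi : 'I_n -> 'cV[C]_2) : (forall i, unit_vector (phi i)) ->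
  energy (hamiltonian g) (product_state phi) =
  spin_energy g (fun i => bloch (phi i)).
Proof.
move=> uphi; rewrite /energy /hamiltonian.
rewrite [X in complex.Re X](_ : _ = (spin_energy g (fun i => bloch (phi i)))%:C) //.
rewrite -scalemxAr -scalemxAl mxE /spin_energy rmorphM /=; congr (_ * _).
rewrite pair_bigA /=.
rewrite mulmx_sumr mulmx_suml summxE rmorph_sum; apply: eq_bigr => -[s a] _.
rewrite -scalemxAr -scalemxAl mxE pauli_string_expectation //.
by rewrite rmorphM.
Qed.

(** Bloch vectors of unit spinors fill the unit sphere, so both suprema are taken
    over the same set. *)
Lemma max_product_energyE (n p : nat) (g : couplings n p -> R) :
  max_product_energy g = (Num.sqrt n%:R)^-1 *
    sup [set spin_energy g b | b in [set b | forall i, unit_sphere (b i)]].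
Proof.
rewrite /max_product_energy; congr (_ * sup _); apply/seteqP; split => e /=.
  move=> [_ [phi uphi <-] <-]; exists (fun i => bloch (phi i)).
    by move=> i; exact: bloch_unit.
  by rewrite energy_product_state.
move=> [b ub <-].
have /choice[phi hphi] : forall i, exists v : 'cV[C]_2, unit_vector v /\ bloch v = b i.
  by move=> i; have [v ? ?] := bloch_surj (ub i); exists v.
exists (product_state phi); first by exists phi => // i; exact: (hphi i).1.
rewrite energy_product_state; last by move=> i; exact: (hphi i).1.
by congr spin_energy; apply/funext => i; exact: (hphi i).2.
Qed.

End SpinEnergy.

(** * Independent standard normal variables *)

Section ChangeOfMeasure.
Context {d d' : measure_display} {T : measurableType d} {S : measurableType d'}.
Context {R : realType}.
Variables (mu : {measure set T -> \bar R}) (nu : {measure set S -> \bar R}).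
Variables (X : T -> S) (G : T -> R) (c : \bar R).
Hypotheses (mX0 : measurable_fun setT X) (mG : measurable_fun setT G).
Hypothesis G0 : forall w, 0 <= G w.
Hypothesis hc : (forall B, measurable B ->
  \int[mu]_w (\1_B (X w) * G w)%:E = c * nu B)%E.
Import HBNNSimple.

Lemma ge0_integral_mul_comp_nnsfun (f : {nnsfun S >-> R}) :
  (\int[mu]_w (f (X w) * G w)%:E = c * \int[nu]_x (f x)%:E)%E.
Proof.
have mi (r : R) : measurable (X @^-1` (f @^-1` [set r])).
  by rewrite -[_ @^-1` _]setTI; apply: mX0 => //; exact: measurable_sfunP.
have mX (B : set S) : measurable B -> measurable_fun setT (fun w => \1_B (X w) : R).
  by move=> mB; apply: (@measurableT_comp _ _ _ _ _ _ (\1_B : S -> R)) => //;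
    exact: measurable_indic.
have mI (r : R) : measurable_fun setT (\1_(f @^-1` [set r]) : S -> R).
  by apply: measurable_indic; exact: measurable_sfunP.
have r0 (r : R) (x : S) : 0 <= r * \1_(f @^-1` [set r]) x.
  have [r0|r0] := leP 0 r; first exact: mulr_ge0.
  by rewrite preimage_nnfun0// indic0 mulr0.
transitivity (\sum_(r \in range f)
    \int[mu]_w (r * \1_(f @^-1` [set r]) (X w) * G w)%:E)%E.
  rewrite -ge0_integral_fsum//; first last.
  - by move=> r w _; rewrite lee_fin mulr_ge0.
  - move=> r; apply/measurable_EFinP/measurable_funM => //.
    by apply: measurable_funM => //; exact: mX.
  apply: eq_integral => w _; rewrite fsumEFin//; congr EFin.
  by rewrite [f (X w)]fimfunE fsbig_finite//= mulr_suml -fsbig_finite.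
have -> : (\int[nu]_x (f x)%:E = \sum_(r \in range f)
    \int[nu]_x (r * \1_(f @^-1` [set r]) x)%:E)%E.
  rewrite -ge0_integral_fsum//; first last.
  - by move=> r w _; rewrite lee_fin.
  - by move=> r; apply/measurable_EFinP; exact: measurable_funM.
  by apply: eq_integral => x _; rewrite fsumEFin// [f x]fimfunE.
rewrite ge0_mule_fsumr; last by move=> r; apply: integral_ge0 => w _; rewrite lee_fin.
apply: eq_fsbigr => r /[!inE] rf.
have r_ge0 : 0 <= r by case: rf => x _ <-.
under eq_integral do rewrite -mulrA EFinM.
rewrite ge0_integralZl_EFin//; first last.
- by apply/measurable_EFinP/measurable_funM => //; exact: mX.
- by move=> w _; rewrite lee_fin mulr_ge0.
rewrite hc//.
under [in RHS]eq_integral do rewrite EFinM.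
rewrite ge0_integralZl_EFin//; first last.
- exact/measurable_EFinP.
by rewrite integral_indic// setIT muleCA.
Qed.

(** The hypothesis is the conclusion for indicator functions; simple functions and
    monotone convergence do the rest. It is used to factor expectations of
    independent variables, where G is the product of the other factors, and
    to integrate against the normal density, where X is the identity. *)
Lemma ge0_integral_mul_comp (f : S -> R) :
  c \is a fin_num ->
  measurable_fun setT f -> (forall x, 0 <= f x) ->
  (\int[mu]_w (f (X w) * G w)%:E = c * \int[nu]_x (f x)%:E)%E.
Proof.
move=> cfin mf f0.
have mEf : measurable_fun setT (EFin \o f) by exact/measurable_EFinP.
pose f_ := nnsfun_approx measurableT mEf.
have mfX n : measurable_fun setT (fun w => f_ n (X w)).
  by apply: measurableT_comp.
have cf x : (f_ n x)%:E @[n --> \oo] --> (f x)%:E.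
  by apply: cvg_nnsfun_approx => // y _; rewrite lee_fin.
have ndf x m n : (m <= n)%N -> f_ m x <= f_ n x.
  by move=> mn; exact/lefP/nd_nnsfun_approx.
have L1 : (\int[mu]_w (f_ n (X w) * G w)%:E)%E @[n --> \oo] -->
    (\int[mu]_w (f (X w) * G w)%:E)%E.
  have -> : (\int[mu]_w (f (X w) * G w)%:E)%E =
      (\int[mu]_w (limn (fun n => (f_ n (X w) * G w)%:E)))%E.
    apply: eq_integral => w _; apply/esym/cvg_lim => //.
    under eq_fun do rewrite EFinM muleC.
    by rewrite EFinM muleC; apply: cvgeZl.
  apply: cvg_monotone_convergence => //.
  - by move=> n; apply/measurable_EFinP/measurable_funM.
  - by move=> n w _; rewrite lee_fin mulr_ge0.
  - by move=> w _ m n mn; rewrite lee_fin ler_wpM2r// ndf.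
have L2 : (\int[nu]_x (f_ n x)%:E)%E @[n --> \oo] -->
    (\int[nu]_x (f x)%:E)%E.
  have -> : (\int[nu]_x (f x)%:E)%E =
      (\int[nu]_x (limn (fun n => (f_ n x)%:E)))%E.
    by apply: eq_integral => x _; apply/esym/cvg_lim.
  apply: cvg_monotone_convergence => //.
  - by move=> n; apply/measurable_EFinP.
  - by move=> n w _; rewrite lee_fin.
  - by move=> w _ m n mn; rewrite lee_fin ndf.
rewrite -(cvg_lim (@ereal_hausdorff R) L1); apply: cvg_lim => //.
rewrite [X in X @ _ --> _](_ : _ = fun n => (c * \int[nu]_x (f_ n x)%:E)%E).
  exact: cvgeZl.
by apply/funext => n; exact: ge0_integral_mul_comp_nnsfun.
Qed.

End ChangeOfMeasure.

Section Independence.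
Context {d : measure_display} {T : measurableType d} {R : realType}.
Variable P : probability T R.
Import HBNNSimple.

Lemma RV_preimage_measurable (X : {RV P >-> R}) (B : set R) :
  measurable B -> measurable (X @^-1` B).
Proof. by move=> mB; rewrite -[X @^-1` B]setTI; exact: measurable_funP. Qed.

Lemma integral_indic_RV (X : {RV P >-> R}) (B : set R) : measurable B ->
  (\int[P]_w (\1_B (X w))%:E = P (X @^-1` B))%E.
Proof.
by move=> mB; rewrite -[in RHS](setIT (X @^-1` B)) -integral_indic//;
  exact: RV_preimage_measurable.
Qed.

(** Independence is the case in which all f i are indicators. General functions are
    admitted one index at a time, the set s being the indices already treated. *)
Lemma integral_prod_independent_aux (I : finType) (X : I -> {RV P >-> R})
    (s : seq I) (f : I -> R -> R) :
  mutually_independent X ->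
  (forall i, i \notin s -> exists2 B, measurable B & f i = \1_B) ->
  (forall i, measurable_fun setT (f i)) -> (forall i x, 0 <= f i x) ->
  (forall i, \int[P]_w (f i (X i w))%:E \is a fin_num)%E ->
  (\int[P]_w (\prod_i f i (X i w))%:E = \prod_i \int[P]_w (f i (X i w))%:E)%E.
Proof.
move=> indX; elim: s f => [|k s IH] f fs mf f0 ffin.
  have /choice[B hB] : forall i, exists B, measurable B /\ f i = \1_B.
    by move=> i; have [//|B mB fB] := fs i; exists B.
  transitivity (\prod_i P (X i @^-1` B i))%E; last first.
    apply: eq_bigr => i _; rewrite (hB i).2 integral_indic_RV//; exact: (hB i).1.
  have mX i : measurable (X i @^-1` B i).
    by apply: RV_preimage_measurable; exact: (hB i).1.
  have := indX [set: I]%SET B (fun i _ => (hB i).1).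
  rewrite (eq_bigl xpredT) => [<-|i]; last by rewrite inE.
  rewrite -[in RHS](setIT (\bigcap_(i in _) _)) -integral_indic//; last first.
    exact: fin_bigcap_measurable.
  apply: eq_integral => w _; congr EFin.
  rewrite indicE; have [wB|wB] := pselect ((\bigcap_(i in [set` [set: I]%SET]) X i
    @^-1` B i) w).
    rewrite mem_set// big1// => i _; rewrite (hB i).2 indicE mem_set//.
    by apply: wB; rewrite /= inE.
  rewrite memNset//; apply/eqP/prodf_eq0.
  move: wB => /existsNP[i /not_implyP[_ wB]]; exists i => //.
  by rewrite (hB i).2 indicE memNset.
have [ks|ks] := boolP (k \in s).
  apply: IH => // i i_s; apply: fs; rewrite inE negb_or i_s andbT.
  by apply: contraNneq i_s => ->.
under eq_integral do rewrite (bigD1 k)//=.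
rewrite [RHS](bigD1 k)//= muleC.
have mfX i : measurable_fun setT (fun w => f i (X i w)).
  by apply: measurableT_comp.
have -> : (\int[P]_w (f k (X k w))%:E = \int[distribution P (X k)]_x (f k x)%:E)%E.
  rewrite (@ge0_integral_distribution _ _ _ _ _ _ _ (fun x => (f k x)%:E))//.
    exact/measurable_EFinP.
  by move=> x; rewrite lee_fin.
apply: (@ge0_integral_mul_comp _ _ _ _ _ P (distribution P (X k)) (X k)
  (fun w => \prod_(i | i != k) f i (X i w)))
  => //; last exact: prode_fin_num.
- under eq_fun do rewrite -big_filter.
  exact: measurable_prod.
- by move=> w; apply: prodr_ge0.
move=> B mB.
pose f' i := if i == k then \1_B : R -> R else f i.
have mB1 : measurable_fun setT (\1_B : R -> R) by exact: measurable_indic.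
have f'k : f' k = \1_B by rewrite /f' eqxx.
have f'n i : i != k -> f' i = f i by rewrite /f' => /negbTE ->.
have IH' : (\int[P]_w (\prod_i f' i (X i w))%:E =
    \prod_i \int[P]_w (f' i (X i w))%:E)%E.
  apply: IH => [i i_s|i|i x|i]; rewrite /f'; case: ifPn => //.
  - by move=> _; exists B.
  - by move=> ik; apply: fs; rewrite inE negb_or ik.
  - by move=> _; rewrite integral_indic_RV// fin_num_measure//;
    exact: RV_preimage_measurable.
transitivity (\prod_(i | i != k) \int[P]_w (f i (X i w))%:E *
    \int[P]_w (f' k (X k w))%:E)%E; last by rewrite f'k integral_indic_RV.
rewrite muleC.
rewrite (eq_bigr (fun i => \int[P]_w (f' i (X i w))%:E)%E); last first.
  by move=> i ik; rewrite f'n.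
rewrite -(@bigD1 _ _ _ _ k xpredT)// -IH'.
apply: eq_integral => w _; rewrite [in RHS](bigD1 k)//=; rewrite f'k; congr ((_ * _)%:E).
by apply: eq_bigr => i ik; rewrite f'n.
Qed.

Lemma integral_prod_independent (I : finType) (X : I -> {RV P >-> R})
    (f : I -> R -> R) :
  mutually_independent X ->
  (forall i, measurable_fun setT (f i)) -> (forall i x, 0 <= f i x) ->
  (forall i, \int[P]_w (f i (X i w))%:E \is a fin_num)%E ->
  (\int[P]_w (\prod_i f i (X i w))%:E = \prod_i \int[P]_w (f i (X i w))%:E)%E.
Proof.
move=> indX mf f0 ffin.
apply: (@integral_prod_independent_aux _ _ (enum I)) => // i.
by rewrite mem_enum.
Qed.

End Independence.

Section GaussianLaplace.
Context {R : realType}.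
Local Notation leb := (@lebesgue_measure R).

Context {d : measure_display} {T : measurableType d}.
Variable P : probability T R.

Lemma ge0_integral_standard_normal (X : {RV P >-> R}) (f : R -> R) :
  standard_normal X ->
  measurable_fun setT f -> (forall x, 0 <= f x) ->
  (\int[P]_w (f (X w))%:E = \int[leb]_x (f x * normal_pdf 0 1 x)%:E)%E.
Proof.
move=> nX mf f0.
transitivity (1 * \int[distribution P X]_x (f x)%:E)%E.
  rewrite mul1e (@ge0_integral_distribution _ _ _ _ _ _ _ (fun x => (f x)%:E))//.
    exact/measurable_EFinP.
apply/esym; apply: (@ge0_integral_mul_comp _ _ _ _ _ leb (distribution P X) id) => //.
- exact: measurable_normal_pdf.
- exact: normal_pdf_ge0.
move=> B mB; transitivity (distribution P X B); last by rewrite mul1e.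
rewrite nX// /normal_prob.
rewrite [RHS]integral_mkcond; apply: eq_integral => x _.
by rewrite patchE indicE; case: ifP => _; rewrite ?mul1r ?mul0r.
Qed.

(** Completing the square turns exp(t x) times the standard normal density into
    exp(t^2 / 2) times the density with mean t. *)
Lemma integral_expR_standard_normal (X : {RV P >-> R}) (t : R) :
  standard_normal X ->
  (\int[P]_w (expR (t * X w))%:E = (expR (t ^+ 2 / 2))%:E)%E.
Proof.
move=> nX.
rewrite (@ge0_integral_standard_normal _ (fun x => expR (t * x)))//; last first.
  by apply: measurableT_comp => //; exact: measurable_funM.
transitivity (\int[leb]_x ((expR (t ^+ 2 / 2))%:E * (normal_pdf t 1 x)%:E))%E.
  apply: eq_integral => x _; rewrite -EFinM; congr EFin.
  rewrite !normal_pdfE ?oner_neq0// mulrCA [RHS]mulrCA; congr (_ * _).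
  by rewrite /normal_fun -!expRD; congr expR; field.
rewrite ge0_integralZl_EFin//.
- by rewrite integral_normal_pdf mule1.
- by move=> x _; rewrite lee_fin normal_pdf_ge0.
- by apply/measurable_EFinP; exact: measurable_normal_pdf.
Qed.

Lemma gaussian_laplace (I : finType) (X : I -> {RV P >-> R}) (t : I -> R) :
  iid_standard_normal X ->
  (\int[P]_w (expR (\sum_i t i * X i w))%:E =
   (expR ((\sum_i t i ^+ 2) / 2))%:E)%E.
Proof.
move=> [indX nX].
under eq_integral do rewrite expR_sum.
rewrite (@integral_prod_independent _ _ _ _ _ X (fun i x => expR (t i * x)))//.
- under eq_bigr do rewrite integral_expR_standard_normal//.
  by rewrite prodEFin -expR_sum mulr_suml.
- by move=> i; apply: measurableT_comp => //; exact: measurable_funM.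
- by move=> i; rewrite integral_expR_standard_normal.
Qed.

End GaussianLaplace.

(** * Integrable variables with a known mean *)

Section HasMean.
Context {d : measure_display} {T : measurableType d} {R : realType}.
Variable P : probability T R.

(** Integrability and value in one relation, so that a pointwise inequality between
    random variables becomes at once an inequality between explicit numbers
    (has_mean_le). *)
Definition has_mean (Y : T -> R) (v : R) : Prop :=
  P.-integrable setT (EFin \o Y) /\ (\int[P]_w (Y w)%:E = v%:E)%E.

Lemma has_mean_expectation (Y : T -> R) (v : R) :
  has_mean Y v -> fine 'E_P[Y]%E = v.
Proof. by move=> [_ Yv]; rewrite unlock Yv. Qed.

Lemma has_mean_cst (v : R) : has_mean (fun=> v) v.
Proof.
split; first exact: finite_measure_integrable_cst.
by rewrite integral_cst//= probability_setT mule1.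
Qed.

Lemma has_meanD (Y Y' : T -> R) (v v' : R) :
  has_mean Y v -> has_mean Y' v' -> has_mean (fun w => Y w + Y' w) (v + v').
Proof.
move=> [iY Yv] [iY' Yv']; split.
  by apply: eq_integrable (integrableD _ iY iY').
under eq_integral do rewrite EFinD.
by rewrite integralD// Yv Yv'.
Qed.

Lemma has_meanZ (c : R) (Y : T -> R) (v : R) :
  has_mean Y v -> has_mean (fun w => c * Y w) (c * v).
Proof.
move=> [iY Yv]; split.
  by apply: eq_integrable (integrableZl _ c iY).
under eq_integral do rewrite EFinM.
by rewrite integralZl// Yv.
Qed.

Lemma has_mean_sum (K : Type) (s : seq K) (Q : pred K) (Y : K -> T -> R)
    (v : K -> R) : (forall k, Q k -> has_mean (Y k) (v k)) ->
  has_mean (fun w => \sum_(k <- s | Q k) Y k w) (\sum_(k <- s | Q k) v k).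
Proof.
move=> h; elim: s => [|k s IH].
  rewrite big_nil (_ : (fun _ => _) = fun=> 0); first exact: has_mean_cst.
  by apply/funext => w; rewrite big_nil.
have [Qk|Qk] := boolP (Q k).
  rewrite big_cons Qk (_ : (fun _ => _) =
      fun w => Y k w + \sum_(k <- s | Q k) Y k w); first by apply: has_meanD; [exact: h|].
  by apply/funext => w; rewrite big_cons Qk.
rewrite big_cons (negbTE Qk) (_ : (fun _ => _) =
    fun w => \sum_(k <- s | Q k) Y k w)//.
by apply/funext => w; rewrite big_cons (negbTE Qk).
Qed.

Lemma has_mean_le (Y Y' : T -> R) (v v' : R) :
  has_mean Y v -> has_mean Y' v' -> (forall w, Y w <= Y' w) -> v <= v'.
Proof.
move=> [iY Yv] [iY' Yv'] YY'; rewrite -lee_fin -Yv -Yv'.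
by apply: le_integral => // w _; rewrite lee_fin.
Qed.

Lemma has_mean_squeeze (Y Y1 : T -> R) (v1 : R) :
  measurable_fun setT Y -> (forall w, 0 <= Y w <= Y1 w) ->
  has_mean Y1 v1 -> exists v, has_mean Y v.
Proof.
move=> mY Y01 [iY1 _].
have iY : P.-integrable setT (EFin \o Y).
  apply: (le_integrable _ _ _ iY1) => //; first exact/measurable_EFinP.
  move=> w _ /=; have /andP[Y0 YY] := Y01 w.
  by rewrite lee_fin !ger0_norm// (le_trans Y0).
exists (fine (\int[P]_w (Y w)%:E)%E); split => //.
by rewrite fineK// integrable_fin_num.
Qed.

Lemma has_mean_gaussian (I : finType) (X : I -> {RV P >-> R}) (t : I -> R) :
  iid_standard_normal X ->
  has_mean (fun w => expR (\sum_i t i * X i w)) (expR ((\sum_i t i ^+ 2) / 2)).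
Proof.
move=> hX; split; last exact: gaussian_laplace.
apply/integrableP; split.
  apply/measurable_EFinP; apply: measurableT_comp => //.
  by apply: measurable_sum => i; exact: measurable_funM.
under eq_integral do rewrite /= ger0_norm ?expR_ge0//.
by rewrite gaussian_laplace// ltry.
Qed.

End HasMean.

(** * A net of the unit sphere *)

Section Net.
Context {R : realType}.
Implicit Types x y v : 'I_3 -> R.

Lemma dotC x y : dot x y = dot y x.
Proof. by apply: eq_bigr => a _; rewrite mulrC. Qed.

Lemma dotZl (c : R) x y : dot (fun a => c * x a) y = c * dot x y.
Proof. by rewrite /dot mulr_sumr; apply: eq_bigr => a _; rewrite mulrA. Qed.

Lemma dot_ge0 x : 0 <= dot x x.
Proof. by apply: sumr_ge0 => a _; rewrite -expr2 sqr_ge0. Qed.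

Lemma dot_self_eq0 x a : dot x x = 0 -> x a = 0.
Proof.
move=> /eqP; rewrite /dot psumr_eq0; last by move=> i _; rewrite -expr2 sqr_ge0.
move=> /allP /(_ a); rewrite mem_index_enum => /(_ isT).
by rewrite -expr2 sqrf_eq0 => /eqP.
Qed.

Lemma sqr_norm3 x : Num.sqrt (dot x x) ^+ 2 = dot x x.
Proof. by rewrite sqr_sqrtr// dot_ge0. Qed.

Lemma dot_sqB (c : R) x y : dot (fun a => c * x a - y a) (fun a => c * x a - y a) =
  c ^+ 2 * dot x x + dot y y - 2 * c * dot x y.
Proof.
rewrite /dot !mulr_sumr -big_split /= -sumrB; apply: eq_bigr => a _; ring.
Qed.

Lemma cauchy_schwarz3 x y :
  dot x y <= Num.sqrt (dot x x) * Num.sqrt (dot y y).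
Proof.
have := sqr_norm3 x; have := sqr_norm3 y.
set s := Num.sqrt (dot x x); set t := Num.sqrt (dot y y) => ht hs.
have s0 : 0 <= s by exact: sqrtr_ge0.
have t0 : 0 <= t by exact: sqrtr_ge0.
have [s1|s1] := eqVneq s 0.
  have x0 a : x a = 0 by apply: dot_self_eq0; rewrite -hs s1 expr0n.
  by rewrite s1 mul0r /dot big1// => a _; rewrite x0 mul0r.
have sp : 0 < s by rewrite lt_def s1 s0.
have := dot_ge0 (fun a => (t / s) * x a - y a).
rewrite dot_sqB -hs -ht.
have -> : (t / s) ^+ 2 * s ^+ 2 + t ^+ 2 - 2 * (t / s) * dot x y =
  2 * (t / s) * (s * t - dot x y) by field.
have [t1|t1] := eqVneq t 0.
  move=> _; rewrite t1 mulr0 dotC.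
  have y0 a : y a = 0 by apply: dot_self_eq0; rewrite -ht t1 expr0n.
  by rewrite /dot big1// => a _; rewrite y0 mul0r.
have tp : 0 < t by rewrite lt_def t1 t0.
rewrite pmulr_rge0 ?subr_ge0//.
by rewrite mulr_gt0 ?divr_gt0.
Qed.

(** A face of the cube [-1, 1]^3 (an axis and a sign) and a point of a grid on it.
    Working on the surface keeps the number of points of order m^2; the
    exponent 2 is what fixes the constant in the theorem. *)
Definition net_index (m : nat) : finType :=
  ('I_3 * bool * 'I_(2 * m).+1 * 'I_(2 * m).+1)%type.

Definition cube_point (m : nat) (k : net_index m) (a : 'I_3) : R :=
  if a == k.1.1.1 then (-1) ^+ k.1.1.2
  else (if a == k.1.1.1 + 1 then k.1.2 else k.2)%:R / m%:R - 1.

Definition net (m : nat) (k : net_index m) (a : 'I_3) : R :=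
  (Num.sqrt (dot (cube_point k) (cube_point k)))^-1 * cube_point k a.

Lemma card_net_index (m : nat) : #|net_index m| = (6 * (2 * m).+1 ^ 2)%N.
Proof. by rewrite !card_prod card_bool !card_ord -!mulnA. Qed.

Lemma cube_point_ge1 (m : nat) (k : net_index m) :
  1 <= dot (cube_point k) (cube_point k).
Proof.
rewrite /dot (bigD1 k.1.1.1)//= {1 2}/cube_point eqxx -expr2 sqrr_sign lerDl.
by apply: sumr_ge0 => a _; rewrite -expr2 sqr_ge0.
Qed.

Lemma net_unit (m : nat) (k : net_index m) : unit_sphere (net k).
Proof.
have h := cube_point_ge1 k.
rewrite /unit_sphere /= /net dotZl dotC dotZl -[X in _ * (_ * X)]sqr_norm3.
by field; rewrite gt_eqF// sqrtr_gt0 (lt_le_trans ltr01).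
Qed.

Lemma grid_approx (m : nat) (M t : R) : (0 < m)%N -> `|t| <= M -> 0 < M ->
  exists j : 'I_(2 * m).+1, (M * (j%:R / m%:R - 1) - t) ^+ 2 <= (M / m%:R) ^+ 2.
Proof.
move=> m0 tM M0.
have mR : 0 < m%:R :> R by rewrite ltr0n.
pose z := (t / M + 1) * m%:R.
have tM1 : -1 <= t / M <= 1.
  rewrite ler_pdivlMr// ler_pdivrMr// mulN1r mul1r.
  by move: tM; rewrite ler_norml.
have z0 : 0 <= z.
  by case/andP: tM1 => h _; apply: mulr_ge0; [lra|exact: ltW].
have [j0 j1] : (Num.truncn z)%:R <= z /\ z < (Num.truncn z).+1%:R.
  by have /andP[] := truncn_itv z0.
have jm : (Num.truncn z < (2 * m).+1)%N.
  case/andP: tM1 => _ h; rewrite ltnS -(ler_nat R) natrM.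
  apply: (le_trans j0); apply: ler_wpM2r; [exact: ltW|lra].
exists (Ordinal jm) => /=.
have -> : M * ((Num.truncn z)%:R / m%:R - 1) - t = M / m%:R * ((Num.truncn z)%:R - z).
  by rewrite /z; field; rewrite !gt_eqF.
rewrite exprMn ler_piMr ?sqr_ge0//.
rewrite -natr1 in j1; set a := _ - z.
have [a0 a1] : a <= 0 /\ -1 <= a by rewrite /a; split; lra.
have -> : a ^+ 2 = 1 - (1 - a) * (1 + a) by ring.
by rewrite lerBlDr lerDl mulr_ge0//; lra.
Qed.

(** Let y be the grid point nearest to v, after scaling v to the surface of the
    cube. Then <y, v> = (|y|^2 + |v|^2 - |y - v|^2) / 2 is at least
    |y| |v| - |y - v|^2 / 2: the error is of second order in the mesh. *)
Lemma net_dense (m : nat) (v : 'I_3 -> R) : (0 < m)%N ->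
  exists k : net_index m,
    (1 - (m%:R ^+ 2)^-1) * Num.sqrt (dot v v) <= dot (net k) v.
Proof.
move=> m0.
have mR : 0 < m%:R :> R by rewrite ltr0n.
pose k := [arg max_(a > (0 : 'I_3)) `|v a|]%O.
have kmax a : `|v a| <= `|v k|.
  by rewrite /k; case: Order.TotalTheory.arg_maxP => // i _; apply.
set M := `|v k| in kmax.
have [M0|M0] := eqVneq M 0.
  have v0 a : v a = 0 by have := kmax a; rewrite M0 normr_le0 => /eqP.
  exists (0, false, ord0, ord0).
  by rewrite /dot !big1 ?sqrtr0 ?mulr0// => a _; rewrite v0 mulr0.
have Mp : 0 < M by rewrite lt_def M0 normr_ge0.
have [j1 h1] := grid_approx m0 (kmax (k + 1)) Mp.
have [j2 h2] := grid_approx m0 (kmax (k + 2%:R)) Mp.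
exists (k, v k < 0, j1, j2).
set y := cube_point (k, v k < 0, j1, j2).
set Y := Num.sqrt (dot y y); set V := Num.sqrt (dot v v).
have Y2 : Y ^+ 2 = dot y y by exact: sqr_norm3.
have V2 : V ^+ 2 = dot v v by exact: sqr_norm3.
have V0 : 0 <= V by exact: sqrtr_ge0.
have Y1 : 1 <= Y by rewrite -sqrtr1 ler_wsqrtr// cube_point_ge1.
have MV : M <= V.
  rewrite /V -[M]ger0_norm ?normr_ge0// -sqrtr_sqr ler_sqrt ?dot_ge0//.
  rewrite /dot (bigD1 k)//= /M -normrX ger0_norm ?sqr_ge0// -expr2 lerDl.
  by apply: sumr_ge0 => a _; rewrite -expr2 sqr_ge0.
have D : dot (fun a => M * y a - v a) (fun a => M * y a - v a) <= 2 * (M / m%:R) ^+ 2.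
  have yk : M * y k - v k = 0.
    rewrite /y /cube_point /= eqxx /M.
    case: ltP => hv; first by rewrite ltr0_norm// expr1; ring.
    by rewrite ger0_norm// expr0; ring.
  have k12 : (k + 1 != k) && (k + 2%:R != k) && (k + 2%:R != k + 1).
    by rewrite -![_ + _ == _](inj_eq val_inj) /=; case: (k) => [[|[|[|//]]]] h.
  case/andP: k12 => /andP[k1 k2] k21.
  rewrite /dot (bigD1 k)//= (bigD1 (k + 1))//= (bigD1 (k + 2%:R)) /=; last by rewrite k2.
  rewrite big1 ?addr0; last first.
    move=> i; rewrite -![_ == _](inj_eq val_inj) /=.
    by case: (k) => [[|[|[|//]]]] hk; case: i => [[|[|[|//]]]] hi.
  rewrite yk mul0r add0r -!expr2 mulrDl mul1r.
  move: h1 h2; rewrite /y /cube_point /= (negbTE k1) (negbTE k2) (negbTE k21) eqxx.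
  exact: lerD.
rewrite dot_sqB -Y2 -V2 in D.
have -> : dot (net (k, v k < 0, j1, j2)) v = dot y v / Y.
  by rewrite /net dotZl mulrC.
rewrite ler_pdivlMr ?(lt_le_trans ltr01)//.
have m2 : 0 < (m%:R ^+ 2)^-1 :> R by rewrite invr_gt0 exprn_gt0.
rewrite expr_div_n in D.
set e := (m%:R ^+ 2)^-1 in D m2 *.
set s := dot y v in D *.
(* expand |M y - v|^2 and use 2 (M Y) V <= (M Y)^2 + V^2 *)
have hs : M * (Y * V - M * e) <= M * s.
  have := sqr_ge0 (M * Y - V); rewrite !expr2 => h; rewrite !expr2 in D; lra.
rewrite ler_pM2l// in hs.
apply: le_trans hs.
have : M * e <= Y * V * e.
  apply: ler_wpM2r; first exact: ltW.
  by apply: (le_trans MV); rewrite ler_peMl.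
lra.
Qed.

End Net.

(** * The energy as a function of the Bloch vectors *)

Section MultiAffine.
Context {R : realType}.
Variables (n p : nat) (g : couplings n p -> R).
Implicit Types b : 'I_n -> 'I_3 -> R.

Definition spins_product b (c : couplings n p) : R :=
  \prod_(j < p) b (site c.1 j) (c.2 j).

Lemma spins_product_affine b (i : 'I_n) (c : couplings n p) :
  exists Av : R * ('I_3 -> R), forall b', (forall k, k != i -> b' k = b k) ->
    spins_product b' c = Av.1 + dot (b' i) Av.2.
Proof.
have [/existsP[j0 /eqP j0i]|hi] := boolP [exists j, site c.1 j == i].
  exists (0, fun a => if a == c.2 j0 then \prod_(j | j != j0) b (site c.1 j) (c.2 j)
    else 0).
  move=> b' b'b /=; rewrite add0r /spins_product (bigD1 j0)//= j0i /dot.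
  rewrite (bigD1 (c.2 j0))//= eqxx [X in _ = _ + X]big1 ?addr0; last first.
    by move=> a /negbTE ->; rewrite mulr0.
  congr (_ * _); apply: eq_bigr => j jj0; rewrite b'b//.
  by rewrite -j0i (inj_eq (@site_inj _ _ _)).
exists (spins_product b c, fun=> 0) => b' b'b /=.
rewrite /dot big1 ?addr0; last by move=> a _; rewrite mulr0.
apply: eq_bigr => j _; rewrite b'b//.
by apply: contraNneq hi => <-; apply/existsP; exists j.
Qed.

Lemma spin_energy_affine b (i : 'I_n) :
  exists (A : R) (v : 'I_3 -> R), forall b', (forall k, k != i -> b' k = b k) ->
    spin_energy g b' = A + dot (b' i) v.
Proof.
have /choice[Av hAv] := spins_product_affine b i.
pose N : R := (Num.sqrt 'C(n, p)%:R)^-1.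
exists (N * \sum_c g c * (Av c).1), (fun a => N * \sum_c g c * (Av c).2 a) => b' b'b.
rewrite /spin_energy -/N.
have -> : dot (b' i) (fun a => N * \sum_c g c * (Av c).2 a) =
    N * \sum_c g c * dot (b' i) (Av c).2.
  rewrite dotC dotZl dotC; congr (_ * _).
  rewrite /dot; under [LHS]eq_bigr do rewrite mulr_sumr.
  rewrite exchange_big; apply: eq_bigr => c _; rewrite mulr_sumr.
  by apply: eq_bigr => a _; rewrite mulrCA.
rewrite -mulrDr -big_split /=; congr (_ * _); apply: eq_bigr => c _.
by rewrite -mulrDr -(hAv c b' b'b).
Qed.

Lemma spin_energyZ (t : R) b :
  spin_energy g (fun i a => t * b i a) = t ^+ p * spin_energy g b.
Proof.
rewrite /spin_energy mulrCA; congr (_ * _).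
rewrite mulr_sumr; apply: eq_bigr => c _.
by rewrite big_split /= prodr_const card_ord mulrCA.
Qed.

(** The dilation of the net that compensates the loss in net_dense. *)
Definition net_scale (m : nat) : R := (1 - (m%:R ^+ 2)^-1)^-1.

Lemma inv_sqr_lt1 (m : nat) : (1 < m)%N -> (m%:R ^+ 2)^-1 < 1 :> R.
Proof. by move=> m1; rewrite invf_lt1 ?exprn_gt0 ?exprn_egt1 ?ltr0n ?ltr1n// ltnW. Qed.

(** The spins move to the dilated net one site at a time. As a function of one spin
    the energy is a constant plus a linear form, and by net_dense the form is
    at least as large at a suitable point of the dilated net. The energy is
    homogeneous of degree p, so the dilation leaves a factor net_scale m ^+ p. *)
Lemma spin_energy_net (m : nat) b : (1 < m)%N -> (forall i, unit_sphere (b i)) ->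
  exists k : {ffun 'I_n -> net_index m},
    spin_energy g b <= net_scale m ^+ p * spin_energy g (fun i => net (k i)).
Proof.
move=> m1 ub.
have s0 : 0 < 1 - (m%:R ^+ 2)^-1 :> R by rewrite subr_gt0 inv_sqr_lt1.
(* the first r spins are on the dilated net, the others are those of b *)
pose hyb (k : {ffun 'I_n -> net_index m}) r (i : 'I_n) (a : 'I_3) : R :=
  if (i < r)%N then net_scale m * net (k i) a else b i a.
suff [k hk] : exists k, spin_energy g b <= spin_energy g (hyb k n).
  exists k; rewrite -spin_energyZ; apply: le_trans hk _.
  rewrite le_eqVlt; apply/orP; left; apply/eqP; congr spin_energy.
  by apply/funext => i; apply/funext => a; rewrite /hyb ltn_ord.
suff : forall r, (r <= n)%N -> exists k, spin_energy g b <= spin_energy g (hyb k r).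
  exact.
elim=> [_|r IH rn].
  exists [ffun=> (0, false, ord0, ord0)].
  by rewrite le_eqVlt (_ : hyb _ _ = b) ?eqxx.
have [k hk] := IH (ltnW rn).
pose i0 := Ordinal rn.
have [A [v hv]] := spin_energy_affine (hyb k r) i0.
have [u hu] := net_dense v (ltnW m1).
exists [ffun i => if i == i0 then u else k i]; apply: le_trans hk _.
rewrite hv// [leRHS]hv; last first.
  move=> i ii0; apply/funext => a; rewrite /hyb ffunE (negbTE ii0).
  by rewrite ltnS leq_eqVlt -(inj_eq val_inj) /= in ii0 *; rewrite (negbTE ii0).
rewrite lerD2l.
have -> : hyb k r i0 = b i0 by apply/funext => a; rewrite /hyb ltnn.
have -> : hyb [ffun i => if i == i0 then u else k i] r.+1 i0 =
    fun a => net_scale m * net u a.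
  by apply/funext => a; rewrite /hyb ltnSn ffunE eqxx.
rewrite dotZl /net_scale ler_pdivlMl//; apply: le_trans hu.
rewrite ler_pM2l//; apply: le_trans (cauchy_schwarz3 _ _) _.
by rewrite (ub i0) sqrtr1 mul1r.
Qed.

End MultiAffine.

Section Overlap.
Context {R : realType}.
Variables (n p : nat).
Implicit Types b : 'I_n -> 'I_3 -> R.

(** The covariance of the energies of b and b' (sum_coefsM). *)
Definition overlap b b' : R :=
  'C(n, p)%:R^-1 * \sum_(s : sites n p) \prod_(j < p) dot (b (site s j)) (b' (site s j)).

Definition coefs b (c : couplings n p) : R :=
  (Num.sqrt 'C(n, p)%:R)^-1 * spins_product b c.

Lemma spin_energy_coefs (g : couplings n p -> R) b :
  spin_energy g b = \sum_c coefs b c * g c.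
Proof.
rewrite /spin_energy mulr_sumr; apply: eq_bigr => c _.
by rewrite /coefs -mulrA [g c * _]mulrC.
Qed.

Lemma sum_coefsM b b' : \sum_c coefs b c * coefs b' c = overlap b b'.
Proof.
rewrite /overlap mulr_sumr -(pair_bigA _ (fun s a => coefs b (s, a) * coefs b' (s, a)))
  /=.
apply: eq_bigr => s _; rewrite /dot bigA_distr_bigA mulr_sumr; apply: eq_bigr => a _.
rewrite /coefs mulrACA /spins_product -big_split /= -invfM -expr2 sqr_sqrtr//.
Qed.

Lemma card_sites : #|sites n p| = 'C(n, p).
Proof. by rewrite card_sig -card_ltn_sorted_tuples; apply: eq_card => x;
  rewrite !inE. Qed.

Lemma overlap_unit b : (p <= n)%N -> (forall i, unit_sphere (b i)) ->
  overlap b b = 1.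
Proof.
move=> pn ub; rewrite /overlap.
under eq_bigr do under eq_bigr do rewrite ub.
under eq_bigr do rewrite big1//.
rewrite sumr_const card_sites mulVf// pnatr_eq0 -lt0n.
by rewrite bin_gt0.
Qed.

End Overlap.

(** * The maximal energy and its upper bound *)

Section SphereMax.
Context {R : realType}.
Variables (n p : nat).
Implicit Types (g : couplings n p -> R).

Definition sphere_max g : R :=
  sup [set spin_energy g b | b in [set b | forall i, unit_sphere (b i)]].

Definition net_energy (m : nat) (k : {ffun 'I_n -> net_index m}) g : R :=
  spin_energy g (fun i => net (k i)).

Definition net_max (m : nat) g : R :=
  \big[Num.max/@net_energy m [ffun=> (0, false, ord0, ord0)] g]_(k :
    {ffun 'I_n -> net_index m})
    net_energy k g.

Lemma net_scale_gt1 (m : nat) : (1 < m)%N -> 1 < net_scale m :> R.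
Proof.
move=> m1; have := @inv_sqr_lt1 R m m1.
have : 0 < (m%:R ^+ 2)^-1 :> R by rewrite invr_gt0 exprn_gt0// ltr0n ltnW.
by move=> h1 h2; rewrite /net_scale invf_gt1; lra.
Qed.

Lemma net_energy_le_max (m : nat) (k : {ffun 'I_n -> net_index m}) g :
  net_energy k g <= net_max m g.
Proof. exact: le_bigmax. Qed.

Lemma spin_energy_le_net_max (m : nat) g b : (1 < m)%N ->
  (forall i, unit_sphere (b i)) -> spin_energy g b <= net_scale m ^+ p * net_max m g.
Proof.
move=> m1 ub; have [k hk] := spin_energy_net g m1 ub.
apply: le_trans hk _; rewrite ler_pM2l ?net_energy_le_max//.
by rewrite exprn_gt0// (lt_trans ltr01)// net_scale_gt1.
Qed.

Lemma sphere_energies_nonempty g :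
  [set spin_energy g b | b in [set b | forall i, unit_sphere (b i)]] !=set0.
Proof.
exists (net_energy ([ffun=> (0, false, ord0, ord0)] : {ffun 'I_n -> net_index 2}) g).
by eexists; [|reflexivity] => i /=; exact: net_unit.
Qed.

Lemma spin_energy_le_sphere_max g b : (forall i, unit_sphere (b i)) ->
  spin_energy g b <= sphere_max g.
Proof.
move=> ub; apply: ub_le_sup; last by exists b.
exists (net_scale 2 ^+ p * net_max 2 g) => _ [b' ub' <-].
exact: spin_energy_le_net_max.
Qed.

Lemma sphere_max_le_net_max (m : nat) g : (1 < m)%N ->
  sphere_max g <= net_scale m ^+ p * net_max m g.
Proof.
move=> m1; apply: ge_sup; first exact: sphere_energies_nonempty.
by move=> _ [b ub <-]; exact: spin_energy_le_net_max.
Qed.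

Lemma net_max_le_sphere_max (m : nat) g : net_max m g <= sphere_max g.
Proof.
by apply/bigmax_leP; split => [|k _]; apply: spin_energy_le_sphere_max => i;
  exact: net_unit.
Qed.

(** sphere_max lies between net_max and c times net_max with the same c > 1, which
    is impossible for a negative number. *)
Lemma sphere_max_ge0 g : (0 < p)%N -> 0 <= sphere_max g.
Proof.
move=> p0; have c1 : 1 < net_scale 2 ^+ p :> R.
  by rewrite exprn_egt1 -?lt0n// net_scale_gt1.
have := @sphere_max_le_net_max 2 g isT.
have := net_max_le_sphere_max 2 g.
move=> h1 h2.
have : 0 <= (net_scale 2 ^+ p - 1) * sphere_max g.
  rewrite mulrBl mul1r subr_ge0; apply: (le_trans h2).
  by rewrite ler_pM2l// (lt_trans ltr01).
by rewrite pmulr_rge0// subr_gt0.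
Qed.

Lemma cvg_net_scale : net_scale m.+2 ^+ p @[m --> \oo] --> (1 : R).
Proof.
have h : (m.+2%:R ^+ 2)^-1 @[m --> \oo] --> (0 : R).
  apply: (@squeeze_cvgr _ _ _ _ (fun=> 0) (@harmonic R)).
  - near=> m; rewrite invr_ge0 exprn_ge0//= /harmonic.
    rewrite lef_pV2 ?posrE ?exprn_gt0 ?ltr0n// -natrX ler_nat.
    by rewrite (leq_trans (leqnSn _))// leq_pmull.
  - exact: cvg_cst.
  - exact: cvg_harmonic.
have h2 : net_scale m.+2 @[m --> \oo] --> (1 : R).
  have -> : 1 = (1 - 0)^-1 :> R by rewrite subr0 invr1.
  apply: cvgV; first by rewrite subr0 oner_neq0.
  by apply: cvgB => //; exact: cvg_cst.
rewrite -[X in _ --> X](expr1n R p).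
by apply: (cvg_comp _ (fun x => x ^+ p)) h2 _; exact: exprn_continuous.
Unshelve. all: by end_near. Qed.

(** This exhibits a supremum over an uncountable set as a limit of finite maxima,
    and so proves it measurable. *)
Lemma cvg_net_max g : (0 < p)%N -> net_max m.+2 g @[m --> \oo] --> sphere_max g.
Proof.
move=> p0.
apply: (@squeeze_cvgr _ _ _ _ (fun m => (net_scale m.+2 ^+ p)^-1 * sphere_max g)
  (fun=> sphere_max g)); last exact: cvg_cst.
  near=> m; rewrite net_max_le_sphere_max andbT.
  rewrite ler_pdivrMl ?sphere_max_le_net_max//.
  by rewrite exprn_gt0// (lt_trans ltr01)// net_scale_gt1.
have {2}-> : sphere_max g = 1^-1 * sphere_max g by rewrite invr1 mul1r.
apply: cvgM; last exact: cvg_cst.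
by apply: cvgV; [exact: oner_neq0|exact: cvg_net_scale].
Unshelve. all: by end_near. Qed.

End SphereMax.

Section MeanMax.
Context {d : measure_display} {T : measurableType d} {R : realType}.
Variable P : probability T R.
Variables (n p : nat) (X : couplings n p -> {RV P >-> R}).
Hypothesis hX : iid_standard_normal X.

Definition disorder (w : T) : couplings n p -> R := fun c => X c w.

Lemma measurable_spin_energy b : measurable_fun setT
  (fun w => spin_energy (disorder w) b).
Proof.
under eq_fun do rewrite spin_energy_coefs.
by apply: measurable_sum => c; exact: measurable_funM.
Qed.

Lemma measurable_net_max m : measurable_fun setT (fun w => net_max m (disorder w)).
Proof.
rewrite /net_max; elim: (index_enum _) => [|k s IH].
  by under eq_fun do rewrite big_nil; exact: measurable_spin_energy.
under eq_fun do rewrite big_cons.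
by apply: measurable_maxr => //; exact: measurable_spin_energy.
Qed.

Lemma measurable_sphere_max : (0 < p)%N ->
  measurable_fun setT (fun w => sphere_max (disorder w)).
Proof.
move=> p0; apply: (@measurable_fun_cvg _ _ _ _ (fun m w => net_max m.+2 (disorder w))).
  by move=> m; exact: measurable_net_max.
by move=> w _; exact: cvg_net_max.
Qed.

Lemma has_mean_exp2 (s t : R) (b b' : 'I_n -> 'I_3 -> R) :
  has_mean P (fun w => expR (s * spin_energy (disorder w) b + t * spin_energy
    (disorder w) b'))
    (expR ((s ^+ 2 * overlap p b b + t ^+ 2 * overlap p b' b' +
            2 * s * t * overlap p b b') / 2)).
Proof.
have := has_mean_gaussian (fun c => s * coefs b c + t * coefs b' c) hX.
rewrite (_ : (fun _ => _) = (fun w => expR (s * spin_energy (disorder w) b + t *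
  spin_energy (disorder w) b'))); last first.
  apply/funext => w; congr expR; rewrite !spin_energy_coefs !mulr_sumr -big_split /=.
  by apply: eq_bigr => c _; rewrite mulrDl !mulrA.
rewrite (_ : \sum_i _ = s ^+ 2 * overlap p b b + t ^+ 2 * overlap p b' b' +
            2 * s * t * overlap p b b')//.
rewrite -!sum_coefsM !mulr_sumr -!big_split /=; apply: eq_bigr => c _; ring.
Qed.

Hypothesis pn : (p <= n)%N.

Lemma has_mean_exp1 (t : R) (b : 'I_n -> 'I_3 -> R) : (forall i, unit_sphere (b i)) ->
  has_mean P (fun w => expR (t * spin_energy (disorder w) b)) (expR (t ^+ 2 / 2)).
Proof.
move=> ub; have := has_mean_exp2 t 0 b b.
rewrite overlap_unit// expr0n /= mulr0 !mul0r !addr0 mulr1.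
by under eq_fun do rewrite mul0r addr0.
Qed.

(** The maximum is at most ln S / l, with S the sum of the exponentials. The tangent
    bound ln S <= S / y - 1 + ln y makes the right-hand side linear in S, so
    that its mean is known. *)
Lemma net_max_le_exp m (l y : R) g : 0 < l -> 0 < y ->
  @net_max R n p m g <= l^-1 * ((\sum_(k : {ffun 'I_n -> net_index m})
    expR (l * net_energy k g)) / y - 1 + ln y).
Proof.
move=> l0 y0; suff h k : @net_energy R n p m k g <= l^-1 *
  ((\sum_(k : {ffun 'I_n -> net_index m})
    expR (l * net_energy k g)) / y - 1 + ln y).
  by apply/bigmax_leP; split => [|k _]; exact: h.
rewrite ler_pdivlMl// -lerBlDr.
set e := net_energy k g; rewrite -lerBlDr opprK.
apply: (@le_trans _ _ (expR (l * e - ln y))); first by rewrite addrC expR_ge1Dx.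
rewrite expRD expRN lnK ?posrE// ler_pM2r ?invr_gt0//.
by rewrite (bigD1 k)//= lerDl; apply: sumr_ge0 => i _; exact: expR_ge0.
Qed.

Lemma has_mean_sphere_max : (0 < p)%N ->
  exists v, has_mean P (fun w => sphere_max (disorder w)) v.
Proof.
move=> p0.
pose Y w := net_scale 2 ^+ p * (1^-1 * ((\sum_(k : {ffun 'I_n -> net_index 2})
    expR (1 * net_energy k (disorder w))) / 1 + (- 1 + ln 1))).
have [v hv] : exists v, has_mean P Y v.
  eexists; apply: has_meanZ; apply: has_meanZ; apply: has_meanD; last exact: has_mean_cst.
  under eq_fun do rewrite mulrC.
  apply: has_meanZ; apply: has_mean_sum => k _.
  by apply: has_mean_exp1 => i; exact: net_unit.
apply: has_mean_squeeze hv; first exact: measurable_sphere_max.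
move=> w; rewrite sphere_max_ge0//= /Y.
apply: le_trans (sphere_max_le_net_max _ (isT : (1 < 2)%N)) _.
rewrite ler_pM2l; last by rewrite exprn_gt0// (lt_trans ltr01)// net_scale_gt1.
by rewrite addrA; apply: net_max_le_exp.
Qed.

Lemma mean_sphere_max_ub m (l v : R) : (1 < m)%N -> 0 < l ->
  has_mean P (fun w => sphere_max (disorder w)) v ->
  v <= net_scale m ^+ p * ((n%:R * ln #|net_index m|%:R) / l + l / 2).
Proof.
move=> m1 l0 hv.
pose M : R := #|{ffun 'I_n -> net_index m}|%:R.
have M0 : 0 < M.
  by rewrite ltr0n; apply/card_gt0P; exists [ffun=> (0, false, ord0, ord0)].
(* the mean of the sum of exponentials, where the tangent bound is sharp *)
pose y := M * expR (l ^+ 2 / 2).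
have y0 : 0 < y by rewrite mulr_gt0 ?expR_gt0.
have hY : has_mean P (fun w => net_scale m ^+ p * (l^-1 *
  (y^-1 * (\sum_(k : {ffun 'I_n -> net_index m})
    expR (l * net_energy k (disorder w))) + (- 1 + ln y))))
   (net_scale m ^+ p * (l^-1 * (y^-1 * (\sum_(k : {ffun 'I_n -> net_index m})
    expR (l ^+ 2 / 2)) + (- 1 + ln y)))).
  apply: has_meanZ; apply: has_meanZ; apply: has_meanD; last exact: has_mean_cst.
  apply: has_meanZ; apply: has_mean_sum => k _.
  by apply: has_mean_exp1 => i; exact: net_unit.
have := has_mean_le hv hY; move/(_ _)/le_trans; apply.
  move=> w; apply: le_trans (sphere_max_le_net_max _ m1) _.
  rewrite ler_pM2l; last by rewrite exprn_gt0// (lt_trans ltr01)// net_scale_gt1.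
  by rewrite addrA [y^-1 * _]mulrC; apply: net_max_le_exp.
rewrite ler_pM2l; last by rewrite exprn_gt0// (lt_trans ltr01)// net_scale_gt1.
have -> : \sum_(k : {ffun 'I_n -> net_index m}) expR (l ^+ 2 / 2) = y.
  by rewrite sumr_const -[LHS]mulr_natl.
rewrite mulVf ?gt_eqF// addrA subrr add0r.
rewrite /y lnM ?posrE ?expR_gt0// expRK /M card_ffun card_ord natrX lnXn; last first.
  by rewrite ltr0n; apply/card_gt0P; exists (0, false, ord0, ord0).
rewrite -[ln _ *+ n]mulr_natl le_eqVlt; apply/orP; left; apply/eqP; field.
by rewrite gt_eqF.
Qed.

End MeanMax.

(** * Elementary symmetric polynomials of bounded numbers *)

Section ElemSym.
Context {R : realType}.
Variables (n : nat).
Implicit Types (D : 'I_n -> R) (B : {set 'I_n}).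

Definition elem_sym (k : nat) D : R :=
  \sum_(B : {set 'I_n} | #|B| == k) \prod_(i in B) D i.

Lemma sum_card_eq (k : nat) :
  \sum_(B : {set 'I_n} | #|B| == k) 1 = 'C(n, k)%:R :> R.
Proof.
have := card_draws 'I_n k; rewrite card_ord => <-.
by rewrite -sum1_card natr_sum; apply: eq_bigl => B; rewrite inE.
Qed.

Definition site_set (p : nat) (s : sites n p) : {set 'I_n} :=
  [set i in val s].

Lemma site_set_inj (p : nat) : injective (@site_set p).
Proof.
move=> s s' /setP ss'; apply/val_inj/val_inj/(inj_map val_inj).
apply: (@irr_sorted_eq _ ltn ltn_trans ltnn _ _ (valP s) (valP s')) => i /=.
by apply/mapP/mapP => -[x xs ->]; exists x => //; have := ss' x; rewrite !inE => h;
  move: xs; rewrite -?h // h.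
Qed.

Lemma card_site_set (p : nat) (s : sites n p) : #|site_set s| = p.
Proof.
rewrite /site_set cardsE (card_uniqP _) ?size_tuple//.
rewrite -(map_inj_uniq val_inj).
exact: (sorted_uniq ltn_trans ltnn (valP s)).
Qed.

(** Increasing p-tuples of sites and p-subsets of sites are in bijection. *)
Lemma sum_sites_elem_sym (p : nat) D :
  \sum_(s : sites n p) \prod_(j < p) D (site s j) = elem_sym p D.
Proof.
have imE : (@site_set p @: [set: sites n p])%SET = [set B : {set 'I_n} | #|B| == p]%SET.
  apply/eqP; rewrite eqEcard; apply/andP; split.
    by apply/fintype.subsetP => _ /imsetP[s _ ->]; rewrite inE card_site_set.
  rewrite card_draws card_ord card_imset; last exact: site_set_inj.
  by rewrite cardsT card_sites.
rewrite /elem_sym (eq_bigl (fun B => B \in (@site_set p @: [set: sites n p])%SET));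
  last first.
  by move=> B; rewrite imE inE.
rewrite big_imset /=; last by move=> s s' _ _; exact: site_set_inj.
apply: eq_big => [s|s _]; first by rewrite inE.
rewrite (_ : \prod_(j in site_set s) D j = \prod_(j <- val s) D j).
  by rewrite big_tuple.
rewrite [RHS]big_uniq.
  by apply: eq_bigl => i; rewrite inE.
rewrite -(map_inj_uniq val_inj).
exact: (sorted_uniq ltn_trans ltnn (valP s)).
Qed.

(** Double counting of the pairs of a set of k + 1 sites and one of its elements. *)
Lemma elem_symS (k : nat) D :
  \sum_(B : {set 'I_n} | #|B| == k) \sum_(i | i \notin B) \prod_(j in i |: B) D j =
  k.+1%:R * elem_sym k.+1 D.
Proof.
rewrite /elem_sym mulr_sumr pair_big_dep /=.
transitivity (\sum_(q : {set 'I_n} * 'I_n | (#|q.1| == k.+1) && (q.2 \in q.1))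
  \prod_(j in q.1) D j).
  rewrite (reindex_onto (fun q : {set 'I_n} * 'I_n => (q.1 :\ q.2, q.2)%SET)
                       (fun q => (q.2 |: q.1, q.2)%SET)) /=; last first.
    by move=> [B i] /= /andP[_ iB]; congr (_, _); exact: finset.setU1K.
  apply: eq_big => [[B i]|[B i]] /=.
    rewrite in_setD1 eqxx /= andbT xpair_eqE eqxx andbT.
    have [iB|iB] := boolP (i \in B).
      by rewrite finset.setD1K// eqxx andbT (cardsD1 i B) iB add1n eqSS andbT.
    rewrite andbF; apply/negbTE; rewrite negb_and orbC.
    apply/orP; left; apply: contraNneq iB => <-; exact: finset.setU11.
  by move=> /andP[_ /eqP[->]].
rewrite -(pair_big_dep (fun B : {set 'I_n} => #|B| == k.+1) (fun B i => i \in B)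
  (fun B _ => \prod_(j in B) D j)) /=.
by apply: eq_bigr => B /eqP Bk; rewrite sumr_const Bk [RHS]mulr_natl.
Qed.

End ElemSym.

Section ElemSymBound.
Context {R : realType}.
Variables (n : nat) (D : 'I_n -> R).
Hypothesis D1 : forall i, `|D i| <= 1.

Lemma norm_prod_le1 (B : {set 'I_n}) : `|\prod_(i in B) D i| <= 1.
Proof. by rewrite normr_prod; apply: Num.Theory.prodr_ile1 => i _;
  rewrite normr_ge0 D1. Qed.

Lemma elem_sym_le (k : nat) : `|elem_sym k D| <= 'C(n, k)%:R.
Proof.
rewrite -sum_card_eq; apply: le_trans (ler_norm_sum _ _ _) _.
by apply: ler_sum => B _; exact: norm_prod_le1.
Qed.

(** The product of the sum of the D i with the k-th symmetric polynomial is
    k + 1 times the next one, up to the terms in which a site is repeated. *)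
Lemma elem_sym_rec (k : nat) :
  k.+1%:R * `|elem_sym k.+1 D| <= `|\sum_i D i| * `|elem_sym k D| + k%:R * 'C(n, k)%:R.
Proof.
rewrite -normrM.
have -> : (\sum_i D i) * elem_sym k D = k.+1%:R * elem_sym k.+1 D +
   \sum_(B : {set 'I_n} | #|B| == k) \sum_(i in B) D i * \prod_(j in B) D j.
  rewrite -elem_symS -big_split /= /elem_sym mulr_sumr; apply: eq_bigr => B _.
  rewrite mulr_suml (bigID (mem B)) /= addrC; congr (_ + _).
  by apply: eq_bigr => i iB; rewrite big_setU1.
set E := \sum_(B | _) _.
have hE : `|E| <= k%:R * 'C(n, k)%:R.
  rewrite -sum_card_eq mulr_sumr; apply: le_trans (ler_norm_sum _ _ _) _.
  apply: ler_sum => B /eqP Bk; apply: le_trans (ler_norm_sum _ _ _) _.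
  rewrite mulr1 -Bk -sum1_card natr_sum; apply: ler_sum => i _.
  by rewrite normrM mulr_ile1 ?norm_prod_le1.
have := ler_normB (k.+1%:R * elem_sym k.+1 D + E) E.
rewrite addrK normrM ger0_norm ?ler0n// => h.
by apply: (le_trans h); rewrite lerD2l.
Qed.

Definition mean_abs : R := `|\sum_i D i| / n%:R.

Lemma mean_abs_le1 : (0 < n)%N -> mean_abs <= 1.
Proof.
move=> n0; rewrite ler_pdivrMr ?ltr0n// mul1r.
apply: le_trans (ler_norm_sum _ _ _) _.
apply: (@le_trans _ _ (\sum_(i < n) 1)); first by apply: ler_sum => i _; exact: D1.
by rewrite sumr_const card_ord.
Qed.

(** Sampling k sites without replacement is the same as sampling them with
    replacement, up to the probability O(k^2 / n) of a repetition. *)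
Lemma elem_sym_mean (k : nat) : (0 < n)%N -> (2 * k <= n)%N ->
  `|elem_sym k D| / 'C(n, k)%:R <= mean_abs ^+ k + 2 * k%:R ^+ 2 / n%:R.
Proof.
move=> n0; have nR : 0 < n%:R :> R by rewrite ltr0n.
have q1 := mean_abs_le1 n0.
have q0 : 0 <= mean_abs by rewrite divr_ge0.
elim: k => [_|k IH kn].
  rewrite bin0 divr1 expr0 mulr0n expr0n /= mulr0 mul0r addr0.
  by have := elem_sym_le 0; rewrite bin0.
have kn' : (k < n)%N by lia.
have {}IH := IH (ltac:(lia)).
have C0 : 0 < 'C(n, k)%:R :> R by rewrite ltr0n bin_gt0 ltnW.
have C1 : 0 < 'C(n, k.+1)%:R :> R by rewrite ltr0n bin_gt0.
have nk : 0 < (n - k)%:R :> R by rewrite ltr0n subn_gt0.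
have CE : k.+1%:R * 'C(n, k.+1)%:R = (n - k)%:R * 'C(n, k)%:R :> R.
  by rewrite -!natrM mul_bin_left.
set r := `|elem_sym k D| / 'C(n, k)%:R in IH.
have r1 : r <= 1 by rewrite ler_pdivrMr// mul1r elem_sym_le.
have r0 : 0 <= r by rewrite divr_ge0.
have step : `|elem_sym k.+1 D| / 'C(n, k.+1)%:R <= (n%:R * mean_abs * r + k%:R) /
  (n - k)%:R.
  rewrite ler_pdivrMr// mulrAC ler_pdivlMr//.
  rewrite -(ler_pM2r C0) -[leLHS]mulrA -CE [leLHS](_ : _ = k.+1%:R * `|elem_sym k.+1 D|
    * 'C(n, k.+1)%:R); last by ring.
  rewrite [leRHS](_ : _ = (n%:R * mean_abs * (r * 'C(n, k)%:R) + k%:R * 'C(n, k)%:R) *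
    'C(n, k.+1)%:R); last by ring.
  rewrite ler_pM2r// /r divfK ?gt_eqF// /mean_abs [n%:R * _]mulrC divfK ?gt_eqF//.
  exact: elem_sym_rec.
apply: (le_trans step).
have -> : n%:R = (n - k)%:R + k%:R :> R by rewrite -natrD subnK// ltnW.
have nk2 : n%:R <= 2 * (n - k)%:R :> R by rewrite -natrM ler_nat; lia.
have -> : (((n - k)%:R + k%:R) * mean_abs * r + k%:R) / (n - k)%:R =
    mean_abs * r + k%:R * (mean_abs * r + 1) / (n - k)%:R.
  by field; rewrite gt_eqF.
have h1 : mean_abs * r <= mean_abs ^+ k.+1 + 2 * k%:R ^+ 2 / n%:R.
  rewrite exprS; apply: le_trans (ler_wpM2l q0 IH) _.
  rewrite mulrDr lerD2l ler_piMl// divr_ge0// mulr_ge0//.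
have h2 : k%:R * (mean_abs * r + 1) / (n - k)%:R <= 4 * k%:R / n%:R.
  rewrite ler_pdivrMr// [leRHS]mulrAC ler_pdivlMr//.
  have : mean_abs * r + 1 <= 2 by have := mulr_ile1 q0 r0 q1 r1; lra.
  move=> h.
  apply: (@le_trans _ _ (k%:R * 2 * n%:R)).
    by rewrite ler_wpM2r ?ler0n// ler_wpM2l.
  by have := ler_wpM2l (ler0n R k) nk2; lra.
have h3 : 2 * k%:R ^+ 2 / n%:R + 4 * k%:R / n%:R <= 2 * k.+1%:R ^+ 2 / n%:R :> R.
  rewrite -mulrDl ler_wpM2r ?invr_ge0 ?ler0n// -natr1 !expr2; lra.
rewrite -natrD subnK; last exact: ltnW.
lra.
Qed.

End ElemSymBound.

(** * Averages over random signs *)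

Section SignChaos.
Context {R : realType}.

(** For z^2 <= 1 / 2 the bounds exp(z) <= 1 / (1 - z) and exp(-z) <= 1 / (1 + z) add
    up to 2 / (1 - z^2); for larger z already |z| <= 2 z^2. *)
Lemma expR_sym_le (z : R) : expR z + expR (- z) <= 2 * expR (2 * z ^+ 2).
Proof.
have [z2|z2] := leP (z ^+ 2) (1 / 2).
  have z1 : -1 < z /\ z < 1 by rewrite expr2 in z2; split; nra.
  have h (w : R) : 0 < 1 - w -> expR w <= (1 - w)^-1.
    move=> w1; rewrite -[leLHS]invrK lef_pV2 ?posrE ?invr_gt0 ?expR_gt0//.
    by rewrite -expRN expR_ge1Dx.
  have h1 := h z (ltac:(lra)); have h2 := h (- z) (ltac:(lra)).
  apply: le_trans (lerD h1 h2) _.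
  have -> : (1 - z)^-1 + (1 - - z)^-1 = 2 * (1 - z ^+ 2)^-1.
    by field; rewrite !gt_eqF//; lra.
  rewrite ler_pM2l//.
  have := expR_ge1Dx (2 * z ^+ 2).
  set y := z ^+ 2 in z2 *; have y0 : 0 <= y by exact: sqr_ge0.
  move=> h3; have y1 : 0 < 1 - y by lra.
  rewrite -(ler_pM2r y1) mulVf ?gt_eqF//.
  apply: (@le_trans _ _ ((1 + 2 * y) * (1 - y))).
    rewrite -subr_ge0 [leRHS](_ : _ = y * (1 - 2 * y)); last by ring.
    by rewrite mulr_ge0//; lra.
  by rewrite ler_pM2r.
have h (w : R) : w ^+ 2 = z ^+ 2 -> expR w <= expR (2 * z ^+ 2).
  move=> wz; rewrite -wz in z2 *; rewrite ler_expR.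
  by have := sqr_ge0 (w - 1 / 2); rewrite sqrrB; lra.
have := lerD (h z erefl) (h (- z) (sqrrN z)); lra.
Qed.

Variable n : nat.
Local Notation signs := {ffun 'I_n -> bool}.
Variable A : 'I_n -> R.
Hypothesis A1 : forall i, `|A i| <= 1.

Definition signed (e : signs) (i : 'I_n) : R := (-1) ^+ e i * A i.

Lemma signed_le1 e i : `|signed e i| <= 1.
Proof. by rewrite normrM normrX normrN1 expr1n mul1r. Qed.

Definition flip (i : 'I_n) (e : signs) : signs :=
  [ffun j => if j == i then ~~ e j else e j].

Lemma flipK i : involutive (flip i).
Proof.
move=> e; apply/ffunP => j; rewrite !ffunE.
by case: eqP => // _; rewrite negbK.
Qed.

(** Averaging over the sign of a single site replaces exp(y^2 / c) by at most
    exp(1 / c) exp(y^2 / (c - 8)), because 1 / c + 8 / c^2 <= 1 / (c - 8); the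
    sites of s are treated one after the other. *)
Lemma sign_subgaussian_aux (s : seq 'I_n) (x c : R) : uniq s -> 8 * (size s)%:R < c ->
  \sum_(e : signs) expR ((x + \sum_(i <- s) signed e i) ^+ 2 / c) <=
  2 ^+ n * (expR ((size s)%:R / (c - 8 * (size s)%:R)) * expR
    (x ^+ 2 / (c - 8 * (size s)%:R))).
Proof.
elim: s x c => [|i s IH] x c /=.
  move=> _ _; rewrite mulr0 subr0 mul0r expR0 mul1r.
  under eq_bigr do rewrite big_nil addr0.
  by rewrite sumr_const card_ffun card_bool card_ord -[expR _ *+ _]mulr_natl natrX.
case/andP => is_ us; rewrite -[(size s).+1%:R]natr1 => hc.
have s0 : 0 <= (size s)%:R :> R by [].
have c8 : 8 < c by lra.
set y := fun e : signs => x + \sum_(j <- s) signed e j.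
have yflip e : y (flip i e) = y e.
  rewrite /y; congr (_ + _); apply: eq_big_seq => j js.
  by rewrite /signed ffunE; case: eqP => // ji; rewrite -ji js in is_.
have sflip e : signed (flip i e) i = - signed e i.
  by rewrite /signed ffunE eqxx signrN mulNr.
(* the two terms are the values at e and at e with the sign of site i flipped *)
have step (e : signs) : expR ((y e + signed e i) ^+ 2 / c) + expR
  ((y e - signed e i) ^+ 2 / c)
   <= 2 * (expR c^-1 * expR ((y e) ^+ 2 / (c - 8))).
  set a := signed e i; set Y := y e.
  have a2 : a ^+ 2 <= 1 by rewrite -real_normK ?num_real// expr_le1 ?signed_le1.
  have -> : (Y + a) ^+ 2 / c = (Y ^+ 2 + a ^+ 2) / c + 2 * Y * a / c by ring.
  have -> : (Y - a) ^+ 2 / c = (Y ^+ 2 + a ^+ 2) / c + - (2 * Y * a / c) by ring.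
  rewrite ![expR (_ / _ + _)]expRD -mulrDr.
  apply: le_trans (ler_wpM2l (expR_ge0 _) (expR_sym_le _)) _.
  rewrite mulrCA ler_pM2l// -!expRD ler_expR.
  have -> : (Y ^+ 2 + a ^+ 2) / c + 2 * (2 * Y * a / c) ^+ 2 =
     a ^+ 2 / c + Y ^+ 2 * (c^-1 + 8 * a ^+ 2 / c ^+ 2) by field; rewrite gt_eqF//; lra.
  apply: lerD.
    by rewrite ler_pdivrMr ?mulVf ?gt_eqF//; lra.
  apply: ler_wpM2l; first exact: sqr_ge0.
  apply: (@le_trans _ _ (c^-1 + 8 / c ^+ 2)).
    by rewrite lerD2l ler_wpM2r ?invr_ge0 ?sqr_ge0//; lra.
  rewrite -subr_ge0.
  have -> : (c - 8)^-1 - (c^-1 + 8 / c ^+ 2) = 64 / ((c - 8) * c ^+ 2).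
    by field; rewrite !gt_eqF//; lra.
  by rewrite divr_ge0// mulr_ge0 ?sqr_ge0//; lra.
have -> : \sum_(e : signs) expR ((x + \sum_(j <- i :: s) signed e j) ^+ 2 / c) =
   2^-1 * \sum_(e : signs) (expR ((y e + signed e i) ^+ 2 / c) + expR
     ((y e - signed e i) ^+ 2 / c)).
  rewrite big_split /= [X in _ + X](reindex_inj (inv_inj (flipK i))) /=.
  under [X in _ + X]eq_bigr do rewrite yflip sflip opprK.
  under eq_bigr do rewrite big_cons addrA addrAC.
  rewrite -mulr2n -[X in _ * X]mulr_natl mulKf ?pnatr_eq0//.
apply: (@le_trans _ _ (expR c^-1 * \sum_(e : signs) expR ((y e) ^+ 2 / (c - 8)))).
  rewrite ler_pdivrMl// !mulr_sumr; apply: ler_sum => e _; exact: step.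
have := IH x (c - 8) us (ltac:(lra)).
rewrite -/y => {}IH.
apply: le_trans (ler_wpM2l (expR_ge0 _) IH) _.
have -> : c - 8 * ((size s)%:R + 1) = c - 8 - 8 * (size s)%:R by ring.
set r := c - 8 - _; have r0 : 0 < r by rewrite /r; lra.
rewrite mulrCA ler_pM2l ?exprn_gt0// mulrA ler_pM2r ?expR_gt0//.
rewrite -expRD ler_expR mulrDl mul1r addrC lerD2l lef_pV2 ?posrE//; rewrite /r; lra.
Qed.

Lemma sign_subgaussian : (0 < n)%N ->
  \sum_(e : signs) expR (n%:R * mean_abs (signed e) ^+ 2 / 16) <= 2 ^+ n * 2.
Proof.
move=> n0; have nR : 0 < n%:R :> R by rewrite ltr0n.
have := @sign_subgaussian_aux (index_enum 'I_n) 0 (16 * n%:R) (index_enum_uniq _).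
rewrite -[index_enum _]enumT size_enum_ord => /(_ (ltac:(lra))).
have -> : 16 * n%:R - 8 * n%:R = 8 * n%:R :> R by ring.
rewrite expr0n /= mul0r expR0 mulr1 => h.
apply: le_trans (_ : _ <= 2 ^+ n * expR (n%:R / (8 * n%:R))) _.
  apply: le_trans h; rewrite le_eqVlt; apply/orP; left; apply/eqP.
  apply: eq_bigr => e _; congr expR; rewrite add0r big_enum /= /mean_abs expr_div_n
    real_normK ?num_real//.
  by field; rewrite gt_eqF.
rewrite ler_pM2l ?exprn_gt0//.
have -> : n%:R / (8 * n%:R) = 8^-1 :> R by field; rewrite gt_eqF.
have := expR_ge1Dx (- 8^-1 : R); rewrite expRN => h1.
rewrite -[leLHS]invrK -[leRHS]invrK lef_pV2 ?posrE ?invr_gt0 ?expR_gt0//.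
lra.
Qed.

End SignChaos.

Section SignChaosBound.
Context {R : realType}.
Variable n : nat.
Local Notation signs := {ffun 'I_n -> bool}.
Variable A : 'I_n -> R.
Hypothesis A1 : forall i, `|A i| <= 1.

(** Orthogonality of the characters of the group of signs. *)
Lemma sum_signs_characters (B B' : {set 'I_n}) :
  \sum_(e : signs) (\prod_(i in B) (-1) ^+ e i) * (\prod_(i in B') (-1) ^+ e i) =
  (if B == B' then 2 ^+ n else 0) :> R.
Proof.
pose f (i : 'I_n) (b : bool) : R :=
  (if i \in B then (-1) ^+ b else 1) * (if i \in B' then (-1) ^+ b else 1).
transitivity (\sum_(e : signs) \prod_i f i (e i)).
  apply: eq_bigr => e _; rewrite big_split /=; congr (_ * _); exact: big_mkcond.
rewrite -(bigA_distr_bigA f).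
have fE i : \sum_(b : bool) f i b = if (i \in B) == (i \in B') then 2 else 0.
  rewrite big_bool /f /=; case: (i \in B); case: (i \in B') => /=;
  rewrite ?expr0 ?expr1 ?mulrNN ?mulr1 ?mul1r ?subrr //=; ring.
under eq_bigr do rewrite fE.
case: eqP => [->|BB'].
  by under eq_bigr do rewrite eqxx; rewrite prodr_const card_ord.
apply/eqP/prodf_eq0.
have /setP : B <> B' by [].
case/boolP: [forall i, (i \in B) == (i \in B')] => [/forallP h|/forallPn[i hi]].
  by case => i; apply/eqP.
by move=> _; exists i; rewrite // (negbTE hi).
Qed.

Lemma sum_signs_elem_sym_sq (p : nat) :
  \sum_(e : signs) elem_sym p (signed A e) ^+ 2 <= 2 ^+ n * 'C(n, p)%:R.
Proof.
pose a (B : {set 'I_n}) := \prod_(i in B) A i.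
pose chi (e : signs) (B : {set 'I_n}) : R := \prod_(i in B) (-1) ^+ e i.
have -> : \sum_(e : signs) elem_sym p (signed A e) ^+ 2 =
  \sum_(B : {set 'I_n} | #|B| == p) \sum_(B' : {set 'I_n} | #|B'| == p)
    a B * a B' * \sum_(e : signs) chi e B * chi e B'.
  transitivity (\sum_(e : signs) \sum_(B : {set 'I_n} | #|B| == p)
     \sum_(B' : {set 'I_n} | #|B'| == p) a B * a B' * (chi e B * chi e B')).
    apply: eq_bigr => e _; rewrite expr2 /elem_sym mulr_suml; apply: eq_bigr => B _.
    rewrite mulr_sumr; apply: eq_bigr => B' _.
    by rewrite /signed !big_split /= -/(chi e B) -/(chi e B') -/(a B) -/(a B'); ring.
  rewrite exchange_big; apply: eq_bigr => B _; rewrite exchange_big /=.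
  by apply: eq_bigr => B' _; rewrite mulr_sumr.
rewrite -sum_card_eq mulr_sumr; apply: ler_sum => B Bp.
rewrite (bigD1 B)//= [X in _ + X]big1 => [|B' /andP[_ BB']]; last first.
  by rewrite sum_signs_characters eq_sym (negbTE BB') mulr0.
rewrite sum_signs_characters eqxx addr0 mulr1 ler_piMl ?exprn_ge0//.
rewrite -expr2 -real_normK ?num_real// expr_le1//.
exact: norm_prod_le1.
Qed.

Lemma expR_le_1D2x (x : R) : 0 <= x -> x <= 1 / 2 -> expR x <= 1 + 2 * x.
Proof.
move=> x0 x1; have := expR_ge1Dx (- x); rewrite expRN => h.
have e0 : 0 < expR x by exact: expR_gt0.
rewrite -(ler_pM2r e0) mulVf ?gt_eqF// in h.
have : (1 + - x) * (1 + 2 * x) >= 1.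
  rewrite -subr_ge0 [leRHS](_ : _ = x * (1 - 2 * x)); last by ring.
  by rewrite mulr_ge0//; lra.
have x2 : 0 < 1 + - x by lra.
by move=> h2; rewrite -(ler_pM2l x2); exact: le_trans h h2.
Qed.

Lemma pow_le_bin (p : nat) : (2 * p <= n)%N ->
  n%:R ^+ p <= 2 ^+ p * p`!%:R * 'C(n, p)%:R :> R.
Proof.
move=> pn.
suff : (n ^ p <= 2 ^ p * n ^_ p)%N.
  rewrite -(ler_nat R) natrX => /le_trans; apply.
  by rewrite -bin_ffact !natrM natrX -mulrA [p`!%:R * _]mulrC.
elim: p pn => [|p IH] pn; first by rewrite ffactn0.
have {}IH := IH (ltac:(lia)).
rewrite expnSr expnS ffactnSr.
by rewrite [(2 * 2 ^ p)%N]mulnC mulnACA; apply: leq_mul => //; lia.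
Qed.

(** Let r be the normalised symmetric polynomial and q the absolute mean of the
    signed numbers. Signs with r <= n^(-2) contribute 1 + O(1 / n). For the
    others 1 <= n^4 r^2, an event of probability at most n^4 / C(n, p). On it
    h r is at most n q^2 / 32 plus a constant, since r <= q^p + O(1 / n) and
    q^p <= q^2 rho^(p - 2); and exp(n q^2 / 16) has a bounded mean by
    sign_subgaussian. *)
Lemma sign_chaos (p : nat) (h l rho : R) :
  (6 <= p)%N -> (2 * p <= n)%N ->
  \sum_i `|A i| <= rho * n%:R -> 64 * l * rho ^+ (p - 2) <= 1 ->
  0 <= h <= 2 * n%:R * l -> 4 * l <= n%:R ->
  \sum_(e : signs) expR (h * (elem_sym p (signed A e) / 'C(n, p)%:R)) <=
  2 ^+ n * (1 + (4 * l + expR (4 * p%:R ^+ 2 * l) * (1 + 2 ^+ p * p`!%:R)) / n%:R).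
Proof.
move=> p6 pn sA hl /andP[h0 h1] ln.
have n0 : (0 < n)%N by lia.
have nR : 0 < n%:R :> R by rewrite ltr0n.
have l0 : 0 <= l by have := le_trans h0 h1; rewrite -mulrA mulrCA pmulr_rge0// pmulr_rge0.
have C0 : 0 < 'C(n, p)%:R :> R by rewrite ltr0n bin_gt0; lia.
set C : R := 'C(n, p)%:R in C0 *.
pose q e := mean_abs (signed A e).
pose r e := elem_sym p (signed A e) / C.
have D1 e i : `|signed A e i| <= 1 by exact: signed_le1.
have q0 e : 0 <= q e by rewrite divr_ge0.
have qrho e : q e <= rho.
  rewrite ler_pdivrMr//; apply: le_trans sA; apply: le_trans (ler_norm_sum _ _ _) _.
  by apply: ler_sum => i _; rewrite normrM normrX normrN1 expr1n mul1r.
have rq e : h * r e <= n%:R * q e ^+ 2 / 32 + 4 * p%:R ^+ 2 * l.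
  have r1 : r e <= q e ^+ p + 2 * p%:R ^+ 2 / n%:R.
    apply: le_trans (ler_norm _) _; rewrite normrM normfV [`|C|]gtr0_norm//.
    exact: elem_sym_mean.
  have qp : q e ^+ p <= q e ^+ 2 * rho ^+ (p - 2).
    rewrite -[in leLHS](subnKC (_ : 2 <= p)%N) ?exprD; last by lia.
    by apply: ler_wpM2l; [exact: sqr_ge0|rewrite lerXn2r ?nnegrE// (le_trans (q0 e))].
  have q2 : 0 <= q e ^+ p + 2 * p%:R ^+ 2 / n%:R.
    by rewrite addr_ge0 ?exprn_ge0// divr_ge0// mulr_ge0.
  apply: le_trans (ler_wpM2l h0 r1) _; apply: le_trans (ler_wpM2r q2 h1) _.
  rewrite mulrDr [X in _ + X <= _](_ : _ = 4 * p%:R ^+ 2 * l); last by field;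
    rewrite gt_eqF.
  rewrite lerD2r.
  apply: le_trans (ler_wpM2l _ qp) _; first by rewrite mulr_ge0// mulr_ge0.
  rewrite [leLHS](_ : _ = n%:R * q e ^+ 2 / 32 * (64 * l * rho ^+ (p - 2)));
    last by field.
  by rewrite ler_piMr// divr_ge0// mulr_ge0// sqr_ge0.
(* the constant left over in rq *)
pose K := expR (4 * p%:R ^+ 2 * l).
have pw e : expR (h * r e) <= expR (2 * l / n%:R) +
    K * (n%:R^-1 * expR (n%:R * q e ^+ 2 / 16) + n%:R ^+ 5 * r e ^+ 2) / 2.
  have K0 : 0 < K by exact: expR_gt0.
  have [rn|rn] := leP (r e) (n%:R ^+ 2)^-1.
    rewrite -[leLHS]addr0 lerD//.
      rewrite ler_expR; apply: le_trans (ler_wpM2l h0 rn) _.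
      apply: le_trans (ler_wpM2r _ h1) _; first by rewrite invr_ge0 sqr_ge0.
      by rewrite le_eqVlt; apply/orP; left; apply/eqP; field; rewrite gt_eqF.
    apply: divr_ge0 => //; apply: mulr_ge0; first exact: ltW.
    by apply: addr_ge0; apply: mulr_ge0; rewrite ?invr_ge0 ?expR_ge0 ?sqr_ge0.
  rewrite -[leLHS]add0r lerD ?expR_ge0//.
  have : expR (h * r e) <= K * expR (n%:R * q e ^+ 2 / 32).
    by rewrite -expRD ler_expR addrC.
  move/le_trans; apply; rewrite -[leRHS]mulrA ler_pM2l//.
  have -> : expR (n%:R * q e ^+ 2 / 16) = expR (n%:R * q e ^+ 2 / 32) ^+ 2.
    by rewrite [RHS]expr2 -expRD; congr expR; field.
  set x := expR _.
  have rn2 : 1 <= n%:R ^+ 4 * r e ^+ 2.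
    have -> : n%:R ^+ 4 * r e ^+ 2 = (n%:R ^+ 2 * r e) ^+ 2 by ring.
    rewrite exprn_ege1//; apply: ltW.
    by rewrite mulrC -ltr_pdivrMr ?exprn_gt0// div1r.
  (* 2 x n <= x^2 + n^2 separates the exponential from the rare event *)
  have := sqr_ge0 (x - n%:R); rewrite sqrrB => hx.
  have : 2 * (x * n%:R) <= x ^+ 2 + n%:R ^+ 2 * (n%:R ^+ 4 * r e ^+ 2).
    have := ler_wpM2l (sqr_ge0 n%:R) rn2; lra.
  move=> hx2; rewrite ler_pdivlMr// -(ler_pM2r nR).
  apply: le_trans (_ : x * 2 * n%:R <= x ^+ 2 + n%:R ^+ 2 * (n%:R ^+ 4 * r e ^+ 2)) _;
    first by lra.
  by rewrite le_eqVlt; apply/orP; left; apply/eqP; field; rewrite gt_eqF.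
apply: le_trans (ler_sum _ (fun e _ => pw e)) _.
rewrite big_split /= sumr_const card_ffun card_bool card_ord
  -[X in X + _ <= _]mulr_natl natrX.
rewrite -mulr_suml -mulr_sumr big_split /= -!mulr_sumr.
have s1 := sign_subgaussian A1 n0.
have s2 : \sum_(e : signs) r e ^+ 2 <= 2 ^+ n / C.
  under eq_bigr do rewrite /r expr_div_n.
  rewrite -mulr_suml ler_pdivrMr ?exprn_gt0// expr2 mulrA divfK ?gt_eqF//.
  exact: sum_signs_elem_sym_sq.
have s3 : n%:R ^+ 5 * (2 ^+ n / C) <= 2 ^+ n * (2 ^+ p * p`!%:R / n%:R).
  rewrite mulrCA ler_pM2l ?exprn_gt0// ler_pdivrMr// mulrAC ler_pdivlMr//.
  rewrite -exprSr; apply: le_trans (pow_le_bin pn).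
  by apply: ler_weXn2l; rewrite ?ler1n.
have s4 : expR (2 * l / n%:R) <= 1 + 4 * l / n%:R.
  apply: le_trans (expR_le_1D2x _ _) _.
  - by rewrite divr_ge0// mulr_ge0.
  - by rewrite ler_pdivrMr//; lra.
  - by rewrite le_eqVlt; apply/orP; left; apply/eqP; ring.
have P0 : 0 < 2 ^+ n :> R by rewrite exprn_gt0.
apply: (@le_trans _ _ (2 ^+ n * (1 + 4 * l / n%:R) +
   K * (n%:R^-1 * (2 ^+ n * 2) + 2 ^+ n * (2 ^+ p * p`!%:R / n%:R)) / 2)).
  apply: lerD; first by rewrite ler_pM2l.
  rewrite ler_pM2r// ler_pM2l ?expR_gt0// lerD//.
    by rewrite ler_pM2l// invr_gt0.
  by apply: le_trans s3; rewrite ler_pM2l// exprn_gt0.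
rewrite -/K -subr_ge0 [leRHS](_ : _ = 2 ^+ n * K * 2 ^+ p * p`!%:R / n%:R / 2);
  last first.
  by field; rewrite gt_eqF.
by rewrite !divr_ge0// !mulr_ge0// ?exprn_ge0// expR_ge0.
Qed.

End SignChaosBound.

(** * The states of the lower bound *)

Section Patch.
Context {R : realType}.
Variable m : nat.
Hypothesis m0 : (0 < m)%N.
Local Notation grid := ('I_m * 'I_m)%type.

(** Points of one face of the cube with nonnegative coordinates, so that the inner
    products of the projected points lie in [0, 1] and the only spins with
    an inner product close to 1 in absolute value are equal or opposite. *)
Definition patch_point (u : grid) : 'I_3 -> R :=
  vec3 1 (u.1%:R / m%:R) (u.2%:R / m%:R).

Definition patch (u : grid) (a : 'I_3) : R :=
  (Num.sqrt (dot (patch_point u) (patch_point u)))^-1 * patch_point u a.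

Lemma coord_itv (j : 'I_m) : 0 <= (j%:R / m%:R : R) <= 1.
Proof.
rewrite divr_ge0//= ler_pdivrMr ?ltr0n// mul1r ler_nat ltnW//.
Qed.

Lemma coord_sep (j j' : 'I_m) : j != j' ->
  (m%:R ^+ 2)^-1 <= (j%:R / m%:R - j'%:R / m%:R) ^+ 2 :> R.
Proof.
move=> jj'; rewrite -mulrBl exprMn exprVn ler_peMl ?invr_ge0 ?sqr_ge0//.
rewrite -real_normK ?num_real// exprn_ege1//.
wlog : j j' jj' / (j < j')%N => [h|lt].
  case: (ltngtP j j') => [|lt|/val_inj e]; first exact: h.
    by rewrite distrC; apply: h; rewrite // eq_sym.
  by rewrite e eqxx in jj'.
rewrite distrC.
rewrite -(natrB R (ltnW lt)).
rewrite normr_nat.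
by rewrite ler1n subn_gt0.
Qed.

Lemma patch_dotE (u u' : grid) : dot (patch u) (patch u') =
  dot (patch_point u) (patch_point u') /
  (Num.sqrt (dot (patch_point u) (patch_point u)) *
   Num.sqrt (dot (patch_point u') (patch_point u'))).
Proof. by rewrite /patch dotZl dotC dotZl dotC invfM; ring. Qed.

Lemma patch_point_ge1 (u : grid) : 1 <= dot (patch_point u) (patch_point u).
Proof. by rewrite /patch_point dotE mulr1 -addrA lerDl -!expr2 addr_ge0 ?sqr_ge0. Qed.

Lemma patch_unit (u : grid) : unit_sphere (patch u).
Proof.
have h := patch_point_ge1 u.
rewrite /unit_sphere /= patch_dotE -expr2 sqr_norm3 divff//.
by rewrite gt_eqF// (lt_le_trans ltr01).
Qed.

Lemma patch_dot_itv (u u' : grid) : 0 <= dot (patch u) (patch u') <= 1.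
Proof.
apply/andP; split; last first.
  by apply: le_trans (cauchy_schwarz3 _ _) _; rewrite !patch_unit sqrtr1 mulr1.
rewrite patch_dotE divr_ge0 ?mulr_ge0 ?sqrtr_ge0// /patch_point dotE.
have /andP[a _] := coord_itv u.1; have /andP[b _] := coord_itv u.2.
have /andP[c _] := coord_itv u'.1; have /andP[e _] := coord_itv u'.2.
by rewrite !addr_ge0 ?mulr_ge0.
Qed.

(** By Lagrange's identity |y|^2 |y'|^2 - <y, y'>^2 is the squared length of the
    cross product, which is at least |y - y'|^2 >= 1 / m^2 because the first
    coordinates of y and y' are both 1. *)
Lemma patch_separated (u u' : grid) : u != u' ->
  dot (patch u) (patch u') <= 1 - (18 * m%:R ^+ 2)^-1.
Proof.
move=> uu'; rewrite patch_dotE.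
set Y := Num.sqrt (dot (patch_point u) _); set Y' := Num.sqrt
  (dot (patch_point u') (patch_point u')).
have Y2 : Y ^+ 2 = dot (patch_point u) (patch_point u) by exact: sqr_norm3.
have Y'2 : Y' ^+ 2 = dot (patch_point u') (patch_point u') by exact: sqr_norm3.
have Y0 : 0 < Y by rewrite sqrtr_gt0 (lt_le_trans ltr01)// patch_point_ge1.
have Y'0 : 0 < Y' by rewrite sqrtr_gt0 (lt_le_trans ltr01)// patch_point_ge1.
rewrite ler_pdivrMr ?mulr_gt0//.
have mR : 0 < m%:R :> R by rewrite ltr0n.
set e := (m%:R ^+ 2)^-1 : R.
have e0 : 0 < e by rewrite invr_gt0 exprn_gt0.
have e1 : e <= 1 by rewrite invf_le1 ?exprn_gt0// exprn_ege1// ler1n.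
have -> : (18 * m%:R ^+ 2)^-1 = e / 18 :> R by rewrite invfM mulrC.
have sep : e <= (u.1%:R / m%:R - u'.1%:R / m%:R) ^+ 2 +
  (u.2%:R / m%:R - u'.2%:R / m%:R) ^+ 2.
  have [u1|u1] := eqVneq u.1 u'.1; last first.
    by apply: le_trans (coord_sep u1) _; rewrite lerDl sqr_ge0.
  have u2 : u.2 != u'.2 by apply: contraNneq uu' => u2;
    rewrite [u]surjective_pairing u1 u2 -surjective_pairing.
  by apply: le_trans (coord_sep u2) _; rewrite lerDr sqr_ge0.
move: Y2 Y'2; rewrite /patch_point !dotE mulr1.
have := coord_itv u.1; have := coord_itv u.2; have := coord_itv u'.1;
  have := coord_itv u'.2.
move: (u.1%:R / m%:R) (u.2%:R / m%:R) (u'.1%:R / m%:R) (u'.2%:R / m%:R) sep => a b c d.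
move=> sep /andP[d0 d1] /andP[c0 c1] /andP[b0 b1] /andP[a0 a1] Y2 Y'2.
have s0 : 0 <= 1 * 1 + a * c + b * d by rewrite mulr1 !addr_ge0 ?mulr_ge0.
rewrite mulr1 in s0 *.
have r0 : 0 <= (1 - e / 18) * (Y * Y').
  by rewrite mulr_ge0 ?mulr_ge0 ?ltW//; lra.
rewrite -ler_sqr ?nnegrE//.
have lag : (1 + a * c + b * d) ^+ 2 = Y ^+ 2 * Y' ^+ 2 -
   ((a - c) ^+ 2 + (b - d) ^+ 2 + (a * d - b * c) ^+ 2) by rewrite Y2 Y'2; ring.
have Y3 : Y ^+ 2 <= 3 by rewrite Y2; nra.
have Y'3 : Y' ^+ 2 <= 3 by rewrite Y'2; nra.
have YY : Y ^+ 2 * Y' ^+ 2 <= 9.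
  by have := ler_pM (sqr_ge0 Y) (sqr_ge0 Y') Y3 Y'3; lra.
rewrite lag.
have -> : ((1 - e / 18) * (Y * Y')) ^+ 2 = Y ^+ 2 * Y' ^+ 2 - (e / 9) *
  (Y ^+ 2 * Y' ^+ 2) + (e / 18) ^+ 2 * (Y ^+ 2 * Y' ^+ 2) by field.
have h1 : e / 9 * (Y ^+ 2 * Y' ^+ 2) <= e.
  have e9 : 0 <= e / 9 by lra.
  by have := ler_wpM2l e9 YY; lra.
have h2 : 0 <= (e / 18) ^+ 2 * (Y ^+ 2 * Y' ^+ 2) by apply: mulr_ge0;
  [exact: sqr_ge0|apply: mulr_ge0; exact: sqr_ge0].
have h3 := sqr_ge0 (a * d - b * c).
have aux (z z9 z18 w x y : R) : z9 <= e -> 0 <= z18 -> 0 <= w -> e <= x + y ->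
  z - (x + y + w) <= z - z9 + z18 by move=> *; lra.
exact: aux.
Qed.

End Patch.

Section PairCounting.
Context {R : realType}.
Variables (n m : nat) (eps : R).
Hypothesis m0 : (0 < m)%N.
Local Notation grid := ('I_m * 'I_m)%type.
Local Notation state := ({ffun 'I_n -> bool} * {ffun 'I_n -> grid})%type.

(** The signs center the spins: over random signs the inner product of two spins
    has mean 0, which makes typical overlaps negligible. *)
Definition spins (k : state) (i : 'I_n) (a : 'I_3) : R :=
  (-1) ^+ k.1 i * patch (k.2 i) a.

Lemma spins_unit (k : state) i : unit_sphere (spins k i).
Proof.
rewrite /unit_sphere /= /spins dotZl dotC dotZl.
by rewrite (patch_unit (k.2 i)) mulr1 -expr2 sqrr_sign.
Qed.

Definition far (u u' : {ffun 'I_n -> grid}) : bool :=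
  eps * n%:R <= (\sum_i (u i != u' i)%:R : R).

Lemma overlap_spins (p : nat) (k k' : state) :
  overlap p (spins k) (spins k') =
  elem_sym p (signed (fun i => (-1) ^+ k'.1 i * dot (patch (k.2 i)) (patch (k'.2 i))) k.1)
    / 'C(n, p)%:R.
Proof.
rewrite /overlap mulrC -sum_sites_elem_sym; congr (_ / _).
apply: eq_bigr => s _; apply: eq_bigr => j _.
by rewrite /spins dotZl dotC dotZl dotC /signed.
Qed.

Lemma far_sum (p : nat) (h l : R) (k' : state) (u : {ffun 'I_n -> grid}) :
  (6 <= p)%N -> (2 * p <= n)%N -> 0 <= eps <= 1 ->
  64 * l * (1 - eps / (18 * m%:R ^+ 2)) ^+ (p - 2) <= 1 ->
  0 <= h <= 2 * n%:R * l -> 4 * l <= n%:R -> far u k'.2 ->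
  \sum_(e : {ffun 'I_n -> bool}) expR (h * overlap p (spins (e, u)) (spins k')) <=
  2 ^+ n * (1 + (4 * l + expR (4 * p%:R ^+ 2 * l) * (1 + 2 ^+ p * p`!%:R)) / n%:R).
Proof.
move=> p6 pn /andP[eps0 eps1] hl hh ln uu'.
under eq_bigr do rewrite overlap_spins /=.
have normA (i : 'I_n) : `|(-1) ^+ k'.1 i * dot (patch (u i)) (patch (k'.2 i))| = dot
  (patch (u i)) (patch (k'.2 i)) :> R.
  rewrite normrM normrX normrN1 expr1n mul1r ger0_norm//.
  by case/andP: (@patch_dot_itv R m m0 (u i) (k'.2 i)).
apply: sign_chaos hl hh ln => //.
  by move=> i; rewrite normA; case/andP: (@patch_dot_itv R m m0 (u i) (k'.2 i)).
under eq_bigr do rewrite normA.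
set t := (18 * m%:R ^+ 2)^-1.
have t0 : 0 <= t :> R by rewrite invr_ge0 mulr_ge0 ?sqr_ge0.
apply: (@le_trans _ _ (\sum_i (1 - t * (u i != k'.2 i)%:R))).
  apply: ler_sum => i _; case: eqP => [_|/eqP hi].
    by rewrite mulr0 subr0; case/andP: (@patch_dot_itv R m m0 (u i) (k'.2 i)).
  by rewrite mulr1; exact: patch_separated.
rewrite sumrB sumr_const card_ord -mulr_sumr mulrBl mul1r.
rewrite lerD2l lerN2 -/t [eps * t]mulrC -mulrA.
exact: ler_wpM2l.
Qed.

(** Chernoff bound: if u is near u', they agree at more than (1 - eps) n sites.
    Weighting each agreement with m^2, the number of grid points, lets the
    sum over u factor over the sites. *)
Lemma near_count (u' : {ffun 'I_n -> grid}) : 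
  \sum_(u : {ffun 'I_n -> grid}) (~~ far u u')%:R <=
  (2 * m%:R ^+ 2) ^+ n * expR (- ((1 - eps) * n%:R * ln (m%:R ^+ 2))) :> R.
Proof.
set x : R := m%:R ^+ 2.
have x1 : 1 <= x by rewrite exprn_ege1// ler1n.
have x0 : 0 < x by rewrite (lt_le_trans ltr01).
pose f (i : 'I_n) (v : grid) : R := if v == u' i then x else 1.
apply: (@le_trans _ _ ((\sum_(u : {ffun 'I_n -> grid}) \prod_i f i (u i)) *
    expR (- ((1 - eps) * n%:R * ln x)))).
  rewrite mulr_suml; apply: ler_sum => u _.
  have [_|/=] := boolP (far u u').
    rewrite mulr_ge0 ?expR_ge0// prodr_ge0// => i _; rewrite /f.
    by case: ifP => // _; exact: ltW.
  rewrite /far -ltNge => hn.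
  have -> : \prod_i f i (u i) = expR (\sum_i (u i == u' i)%:R * ln x).
    rewrite expR_sum; apply: eq_bigr => i _; rewrite /f.
    by case: eqP => _; rewrite ?mul1r ?lnK ?posrE// mul0r expR0.
  rewrite -expRD -[leLHS]expR0 ler_expR -mulr_suml -mulrBl mulr_ge0 ?ln_ge0//.
  have : \sum_i (u i == u' i)%:R = n%:R - \sum_i (u i != u' i)%:R :> R.
    apply/eqP; rewrite -subr_eq opprK -big_split /=.
    rewrite (eq_bigr (fun=> 1)) ?sumr_const ?card_ord// => i _.
    by case: eqP => _; rewrite ?addr0 ?add0r.
  move=> ->; lra.
rewrite ler_wpM2r ?expR_ge0// -(bigA_distr_bigA f).
rewrite -[n in _ ^+ n]card_ord -prodr_const.
apply: ler_prod => i _; apply/andP; split.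
  by apply: sumr_ge0 => v _; rewrite /f; case: ifP => // _; exact: ltW.
rewrite (bigD1 (u' i))//= {1}/f eqxx mulrDl mul1r lerD2l.
apply: (@le_trans _ _ (\sum_(v : grid) 1)).
  rewrite [leRHS](bigD1 (u' i))//= -[leLHS]add0r lerD//.
  by apply: ler_sum => v /negbTE; rewrite /f => ->.
by rewrite sumr_const card_prod !card_ord natrM -expr2.
Qed.

End PairCounting.

(** * The truncated second moment *)

Section Truncation.
Context {R : realType}.
Variables (beta eps : R).
Hypotheses (beta0 : 0 <= beta) (eps0 : 0 <= eps <= 1).

(** Without the upper cut, pairs of almost equal states would dominate the second
    moment as soon as beta^2 exceeds the logarithm of the number of states,
    which is half of the value needed. The lower cut makes a positive sum of
    truncated exponentials imply the presence of a large energy. *)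
Definition truncated (x : R) : R :=
  if (1 - eps) * beta <= x <= (1 + eps) * beta then expR (beta * x) else 0.

(** Each of the two subtracted terms exceeds exp(beta x) on one side of the
    window of truncated. *)
Definition trunc_low (x : R) : R :=
  expR (beta * x)
  - expR (eps * (1 - eps) * beta ^+ 2) * expR ((1 - eps) * beta * x)
  - expR (- (eps * (1 + eps) * beta ^+ 2)) * expR ((1 + eps) * beta * x).

Lemma trunc_low_le x : trunc_low x <= truncated x.
Proof.
case/andP: eps0 => e0 e1; rewrite /trunc_low /truncated -!expRD.
have eb : 0 <= eps * beta by exact: mulr_ge0.
have h1 := expR_ge0 (eps * (1 - eps) * beta ^+ 2 + (1 - eps) * beta * x).
have h2 := expR_ge0 (- (eps * (1 + eps) * beta ^+ 2) + (1 + eps) * beta * x).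
case: ifPn; first by lra.
rewrite negb_and -!ltNge => /orP[hx|hx].
  suff : expR (beta * x) <= expR (eps * (1 - eps) * beta ^+ 2 + (1 - eps) * beta * x)
    by lra.
  rewrite ler_expR -subr_ge0 [leRHS](_ : _ = (eps * beta) * ((1 - eps) * beta - x));
    last by ring.
  by rewrite mulr_ge0// subr_ge0 ltW.
suff : expR (beta * x) <= expR (- (eps * (1 + eps) * beta ^+ 2) + (1 + eps) * beta * x)
  by lra.
rewrite ler_expR -subr_ge0 [leRHS](_ : _ = (eps * beta) * (x - (1 + eps) * beta));
  last by ring.
by rewrite mulr_ge0// subr_ge0 ltW.
Qed.

(** For pairs with a small covariance the truncation may be dropped. For the others
    beta (x + y) / 2 is replaced by its bound (1 + eps) beta^2. *)
Definition pair_up (far : bool) (x y : R) : R :=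
  if far then expR (beta * x + beta * y)
  else expR ((1 + eps) * beta ^+ 2) * expR (beta / 2 * x + beta / 2 * y).

Lemma truncatedM_le far x y : truncated x * truncated y <= pair_up far x y.
Proof.
rewrite /truncated /pair_up.
have p0 : 0 <= (if far then expR (beta * x + beta * y)
  else expR ((1 + eps) * beta ^+ 2) * expR (beta / 2 * x + beta / 2 * y)).
  by case: far; rewrite ?mulr_ge0 ?expR_ge0.
case: ifP => [/andP[_ hx]|_]; last by rewrite mul0r.
case: ifP => [/andP[_ hy]|_]; last by rewrite mulr0.
rewrite -expRD; case: far p0 => // _; rewrite -expRD ler_expR.
have hx' := ler_wpM2l beta0 hx; have hy' := ler_wpM2l beta0 hy.
rewrite expr2; lra.
Qed.

(** The second moment method as a pointwise inequality. With Z the sum of the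
    truncated exponentials, 2 t Z - (t Z)^2 is at most 1, and it vanishes unless
    some x k reaches (1 - eps) beta; so it is a lower bound for the indicator
    of the event that F reaches this level. The term with k0 accounts for the
    complement, where F could be negative. *)
Lemma truncated_second_moment (K : finType) (x : K -> R) (F t : R)
    (fr : K -> K -> bool) (k0 : K) :
  (forall k, x k <= F) -> 0 <= t ->
  (1 - eps) * beta * (2 * t * (\sum_k trunc_low (x k)) -
     t ^+ 2 * (\sum_k \sum_k' pair_up (fr k k') (x k) (x k')))
  - (expR (x k0) + expR (- x k0)) <= F.
Proof.
move=> hF t0; case/andP: eps0 => e0 e1.
have u0 : 0 <= (1 - eps) * beta by rewrite mulr_ge0// subr_ge0.
pose Z := \sum_k truncated (x k).
have ZL : \sum_k trunc_low (x k) <= Z by apply: ler_sum => k _; exact: trunc_low_le.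
have ZU : Z ^+ 2 <= \sum_k \sum_k' pair_up (fr k k') (x k) (x k').
  rewrite expr2 /Z mulr_suml; apply: ler_sum => k _; rewrite mulr_sumr.
  by apply: ler_sum => k' _; exact: truncatedM_le.
have h1 : 2 * t * (\sum_k trunc_low (x k)) -
     t ^+ 2 * (\sum_k \sum_k' pair_up (fr k k') (x k) (x k')) <= 2 * t * Z - t ^+ 2 * Z
       ^+ 2.
  apply: lerB; first by apply: ler_wpM2l => //; rewrite mulr_ge0.
  by apply: ler_wpM2l => //; exact: sqr_ge0.
have ax : - (expR (x k0) + expR (- x k0)) <= x k0 /\ 0 <= expR (x k0) + expR (- x k0).
  have := expR_ge1Dx (- x k0); have := expR_ge0 (x k0); have := expR_ge0 (- x k0).
  by have := expR_ge1Dx (x k0); split; lra.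
case: ax => ax1 ax2.
have [/existsP[k hk]|/existsPn hk] := boolP [exists k, (1 - eps) * beta <= x k].
  have h2 : 2 * t * Z - t ^+ 2 * Z ^+ 2 <= 1 by have := sqr_ge0 (t * Z - 1);
    rewrite sqrrB exprMn; lra.
  have := ler_wpM2l u0 (le_trans h1 h2); have := hF k; lra.
have Z0 : Z = 0.
  by rewrite /Z big1// => k _; rewrite /truncated (negbTE (hk k)).
rewrite Z0 expr0n /= !mulr0 subr0 in h1.
have := ler_wpM2l u0 h1; have := hF k0; lra.
Qed.

End Truncation.

Section MeanLower.
Context {d : measure_display} {T : measurableType d} {R : realType}.
Variable P : probability T R.
Variables (n p m : nat) (X : couplings n p -> {RV P >-> R}).
Hypothesis hX : iid_standard_normal X.
Hypotheses (m0 : (0 < m)%N) (p6 : (6 <= p)%N) (pn : (2 * p <= n)%N).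
Variables (kappa eps l v : R).
Hypotheses (eps0 : 0 < eps <= 1) (kappa0 : 0 < kappa <= 1) (l0 : 0 < l).
Hypothesis far_cond : 64 * l * (1 - eps / (18 * m%:R ^+ 2)) ^+ (p - 2) <= 1.
Hypothesis near_cond : kappa * l * (1 + 2 * eps) + 2 <= (1 - eps) * ln (m%:R ^+ 2).
Hypothesis nl : 4 * l <= n%:R.
Hypothesis hv : has_mean P (fun w => sphere_max (disorder X w)) v.

Local Notation grid := ('I_m * 'I_m)%type.
Local Notation state := ({ffun 'I_n -> bool} * {ffun 'I_n -> grid})%type.
Let beta : R := Num.sqrt (2 * kappa * n%:R * l).
Let M : R := #|{: state}|%:R.
Let xs (k : state) (w : T) : R := spin_energy (disorder X w) (@spins R n m k).
Let K : R := 4 * l + expR (4 * p%:R ^+ 2 * l) * (1 + 2 ^+ p * p`!%:R).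
Let fr (k k' : state) : bool := far eps k.2 k'.2.

Let nR : 0 < n%:R :> R. Proof. by rewrite ltr0n; lia. Qed.

Let beta2 : beta ^+ 2 = 2 * kappa * n%:R * l.
Proof. by rewrite sqr_sqrtr// !mulr_ge0// ltW//; case/andP: kappa0. Qed.

Let ME : M = 2 ^+ n * (m%:R ^+ 2) ^+ n.
Proof.
by rewrite /M card_prod !card_ffun card_prod !card_ord card_bool natrM !natrX natrM
  -expr2.
Qed.

Let M0 : 0 < M. Proof. by rewrite ME mulr_gt0 ?exprn_gt0// ltr0n. Qed.

Let pn' : (p <= n)%N.
Proof. by apply: leq_trans pn; rewrite leq_pmull. Qed.

Let ov1 (k : state) : overlap p (@spins R n m k) (spins k) = 1.
Proof. by apply: overlap_unit => // i; exact: spins_unit. Qed.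

Let ov_le1 (k k' : state) : overlap p (@spins R n m k) (spins k') <= 1.
Proof.
have C0 : 0 < 'C(n, p)%:R :> R by rewrite ltr0n bin_gt0.
rewrite overlap_spins ler_pdivrMr// mul1r; apply: le_trans (ler_norm _) _.
apply: elem_sym_le => i; apply: signed_le1 => j.
rewrite normrM normrX normrN1 expr1n mul1r ger0_norm//;
by case/andP: (@patch_dot_itv R m m0 (k.2 j) (k'.2 j)).
Qed.

Let pair_mean (k k' : state) : R :=
  if fr k k' then expR (beta ^+ 2) * expR (beta ^+ 2 * overlap p (@spins R n m k)
    (spins k'))
  else expR ((1 + eps) * beta ^+ 2) * expR (beta ^+ 2 / 4 *
    (1 + overlap p (@spins R n m k) (spins k'))).

Let has_mean_pair (k k' : state) :
  has_mean P (fun w => pair_up beta eps (fr k k') (xs k w) (xs k' w)) (pair_mean k k').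
Proof.
rewrite /pair_up /pair_mean; case: (fr k k').
  rewrite -expRD.
  have := has_mean_exp2 hX beta beta (spins k) (spins k'); rewrite !ov1.
  by congr (has_mean _ _ (expR _)); field.
apply: has_meanZ.
have := has_mean_exp2 hX (beta / 2) (beta / 2) (spins k) (spins k'); rewrite !ov1.
by congr (has_mean _ _ (expR _)); field.
Qed.

Let has_mean_low (k : state) :
  has_mean P (fun w => trunc_low beta eps (xs k w))
    (expR (beta ^+ 2 / 2) * (1 - 2 * expR (- (eps ^+ 2 * beta ^+ 2 / 2)))).
Proof.
have h1 t := has_mean_exp1 hX pn' t (fun i => spins_unit k i).
have := has_meanD (has_meanD (h1 beta)
  (has_meanZ (- expR (eps * (1 - eps) * beta ^+ 2)) (h1 ((1 - eps) * beta))))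
  (has_meanZ (- expR (- (eps * (1 + eps) * beta ^+ 2))) (h1 ((1 + eps) * beta))).
congr (has_mean _ _ _).
  by apply/funext => w; rewrite /trunc_low !mulNr.
have -> : - expR (eps * (1 - eps) * beta ^+ 2) * expR (((1 - eps) * beta) ^+ 2 / 2) =
   - (expR (beta ^+ 2 / 2) * expR (- (eps ^+ 2 * beta ^+ 2 / 2))).
  by rewrite mulNr -!expRD; congr (- expR _); field.
have -> : - expR (- (eps * (1 + eps) * beta ^+ 2)) * expR (((1 + eps) * beta) ^+ 2 / 2) =
   - (expR (beta ^+ 2 / 2) * expR (- (eps ^+ 2 * beta ^+ 2 / 2))).
  by rewrite mulNr -!expRD; congr (- expR _); field.
ring.
Qed.

Let far_total :
  \sum_(k : state) \sum_(k' : state) (if fr k' k then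
     expR (beta ^+ 2 * overlap p (@spins R n m k') (spins k)) else 0) <=
  M * (M * (1 + K / n%:R)).
Proof.
have hb : 0 <= beta ^+ 2 <= 2 * n%:R * l.
  rewrite sqr_ge0/= beta2 -!mulrA ler_pM2l// mulrC ler_piMr//.
    by rewrite mulr_ge0// ltW.
  by case/andP: kappa0.
have K0 : 0 <= 1 + K / n%:R.
  rewrite addr_ge0// divr_ge0// addr_ge0// ?mulr_ge0 ?expR_ge0 ?addr_ge0 ?mulr_ge0
    ?exprn_ge0//.
  by rewrite ltW.
apply: (@le_trans _ _ (\sum_(k : state) M * (1 + K / n%:R))); last first.
  by rewrite sumr_const -[leLHS]mulr_natl.
apply: ler_sum => k _.
rewrite -(pair_bigA _ (fun e u => if fr (e, u) k then
     expR (beta ^+ 2 * overlap p (@spins R n m (e, u)) (spins k)) else 0)) /=.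
rewrite exchange_big /=.
apply: (@le_trans _ _ (\sum_(u : {ffun 'I_n -> grid}) 2 ^+ n * (1 + K / n%:R))).
  apply: ler_sum => u _; rewrite /fr /=.
  have [fu|fu] := boolP (far eps u k.2).
    have e01 : 0 <= eps <= 1 by case/andP: eps0 => /ltW -> ->.
    exact: (@far_sum R n m eps m0 p (beta ^+ 2) l k u p6 pn e01 far_cond hb nl fu).
  by rewrite big1 ?mulr_ge0 ?exprn_ge0.
rewrite sumr_const -[leLHS]mulr_natl card_ffun card_prod !card_ord natrX natrM -expr2 ME.
by rewrite mulrCA mulrA.
Qed.

Let near_total :
  \sum_(k : state) \sum_(k' : state) (~~ fr k' k)%:R <=
  M * (2 ^+ n * ((2 * m%:R ^+ 2) ^+ n * expR (- ((1 - eps) * n%:R * ln (m%:R ^+ 2)))))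
    :> R.
Proof.
set B := (_ ^+ n * expR _).
apply: (@le_trans _ _ (\sum_(k : state) 2 ^+ n * B)); last first.
  by rewrite sumr_const -[leLHS]mulr_natl.
apply: ler_sum => k _.
rewrite -(pair_bigA _ (fun e u => (~~ fr (e, u) k)%:R)) /=.
apply: (@le_trans _ _ (\sum_(e : {ffun 'I_n -> bool}) B)); last first.
  by rewrite sumr_const -[leLHS]mulr_natl card_ffun card_bool card_ord natrX.
by apply: ler_sum => e _; exact: near_count.
Qed.

(** Far pairs contribute 1 + K / n times the square of the first moment. Near pairs
    carry an excess factor exp((1 / 2 + eps) beta^2), which near_cond keeps
    below the inverse of their proportion, with a factor exp(-n) to spare. *)
Let pair_mean_total :
  \sum_(k : state) \sum_(k' : state) pair_mean k' k <=
  expR (beta ^+ 2) * M ^+ 2 * (1 + (K + 1) / n%:R).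
Proof.
case/andP: eps0 => e0 e1.
apply: (@le_trans _ _ (expR (beta ^+ 2) * (M * (M * (1 + K / n%:R))) +
  expR ((3 / 2 + eps) * beta ^+ 2) * (M * (2 ^+ n *
    ((2 * m%:R ^+ 2) ^+ n * expR (- ((1 - eps) * n%:R * ln (m%:R ^+ 2)))))))).
  apply: le_trans (lerD (ler_wpM2l (expR_ge0 _) far_total)
    (ler_wpM2l (expR_ge0 _) near_total)).
  rewrite !mulr_sumr -big_split; apply: ler_sum => k _ /=.
  rewrite !mulr_sumr -big_split; apply: ler_sum => k' _ /=.
  rewrite /pair_mean; case: (fr k' k) => /=; first by rewrite mulr0 addr0.
  rewrite mulr0 add0r mulr1 -expRD ler_expR.
  have := ler_wpM2l (sqr_ge0 beta) (ov_le1 k' k); lra.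
set Q := (1 - eps) * n%:R * ln (m%:R ^+ 2).
have h : expR ((3 / 2 + eps) * beta ^+ 2) * (2 ^+ n * expR (- Q)) <= expR (beta ^+ 2) /
  n%:R.
  have h2 : 2 ^+ n <= expR n%:R :> R.
    rewrite -[X in expR X]mulr1 expRM_natl lerXn2r ?nnegrE ?expR_ge0//.
    by have := expR_ge1Dx (1 : R); lra.
  have hn : n%:R <= expR n%:R :> R by have := expR_ge1Dx (n%:R : R); lra.
  apply: (@le_trans _ _ (expR ((3 / 2 + eps) * beta ^+ 2) * (expR n%:R * expR (- Q)))).
    by rewrite ler_pM2l ?expR_gt0// ler_pM2r ?expR_gt0.
  apply: (@le_trans _ _ (expR (beta ^+ 2) * expR (- n%:R))); last first.
    by rewrite ler_pM2l ?expR_gt0// expRN lef_pV2 ?posrE ?expR_gt0.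
  rewrite -!expRD ler_expR beta2 /Q.
  have := ler_wpM2l (ltW nR) near_cond; lra.
have -> : expR ((3 / 2 + eps) * beta ^+ 2) * (M * (2 ^+ n *
  ((2 * m%:R ^+ 2) ^+ n * expR (- Q)))) =
   M ^+ 2 * (expR ((3 / 2 + eps) * beta ^+ 2) * (2 ^+ n * expR (- Q))).
  have -> : (2 * m%:R ^+ 2) ^+ n = M by rewrite ME exprMn.
  ring.
apply: le_trans (lerD (lexx _) (ler_wpM2l (sqr_ge0 M) h)) _.
by rewrite le_eqVlt; apply/orP; left; apply/eqP; field; rewrite gt_eqF.
Qed.

(** With t the inverse of the mean of the sum of exponentials, the quadratic
    expression of truncated_second_moment has mean at least
    2 - O(1 / n) - (1 + O(1 / n)). *)
Lemma mean_sphere_max_lb :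
  (1 - eps) * beta * (1 - (K + 1 + 4 / (eps ^+ 2 * kappa * l)) / n%:R) - 4 <= v.
Proof.
case/andP: eps0 => e0 e1; case/andP: (kappa0) => kp k1.
have b0 : 0 <= beta by exact: sqrtr_ge0.
pose k0 : state := ([ffun=> false], [ffun=> (Ordinal m0, Ordinal m0)]).
pose t := (M * expR (beta ^+ 2 / 2))^-1.
have t0 : 0 < t by rewrite invr_gt0 mulr_gt0 ?expR_gt0.
have pw w := @truncated_second_moment _ beta eps b0 (_ : 0 <= eps <= 1) _ (xs^~ w)
  (sphere_max (disorder X w)) t (fun k k' => fr k' k) k0.
have hmean : has_mean P (fun w => (1 - eps) * beta *
  (2 * t * (\sum_k trunc_low beta eps (xs k w)) +
     - t ^+ 2 * (\sum_k \sum_k' pair_up beta eps (fr k' k) (xs k w) (xs k' w)))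
  + (-1) * (expR (1 * xs k0 w) + expR ((-1) * xs k0 w)))
  ((1 - eps) * beta * (2 * t * (\sum_(k : state) (expR (beta ^+ 2 / 2) *
    (1 - 2 * expR (- (eps ^+ 2 * beta ^+ 2 / 2))))) +
     - t ^+ 2 * (\sum_(k : state) \sum_(k' : state) pair_mean k' k))
  + (-1) * (expR (1 ^+ 2 / 2) + expR ((-1) ^+ 2 / 2))).
  have h1 s := has_mean_exp1 hX pn' s (fun i => spins_unit k0 i).
  apply: has_meanD; apply: has_meanZ; apply: has_meanD.
  - by apply: has_meanZ; apply: has_mean_sum => k _; exact: has_mean_low.
  - apply: has_meanZ; apply: has_mean_sum => k _; apply: has_mean_sum => k' _.
    have := has_mean_pair k' k; congr (has_mean _ _ _); apply/funext => w.
    by rewrite /pair_up; case: (fr k' k); [rewrite addrC|rewrite [X in _ * expR X]addrC].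
  - exact: h1.
  - exact: h1.
apply: le_trans (has_mean_le hmean hv _); last first.
  move=> w; rewrite mulN1r mul1r mulN1r mulNr.
  apply: pw => //; [by rewrite e1 ltW|by move=> k;
    apply: spin_energy_le_sphere_max => i; exact: spins_unit|exact: ltW].
rewrite mulN1r expr1n sqrrN expr1n.
have e12 : expR (1 / 2) <= 2 :> R.
  by have := @expR_le_1D2x R (1 / 2); lra.
rewrite lerD//; last by rewrite lerN2; lra.
apply: ler_wpM2l; first by rewrite mulr_ge0// subr_ge0.
have -> : \sum_(k : state) (expR (beta ^+ 2 / 2) *
  (1 - 2 * expR (- (eps ^+ 2 * beta ^+ 2 / 2)))) =
   t^-1 * (1 - 2 * expR (- (eps ^+ 2 * beta ^+ 2 / 2))).
  by rewrite sumr_const -[LHS]mulr_natl /t invrK mulrA.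
have tt : t ^+ 2 * (expR (beta ^+ 2) * M ^+ 2) = 1.
  have -> : expR (beta ^+ 2) = expR (beta ^+ 2 / 2) ^+ 2.
    by rewrite [RHS]expr2 -expRD; congr expR; field.
  by rewrite -!exprMn /t [expR _ * M]mulrC mulVf ?expr1n// gt_eqF// mulr_gt0 ?expR_gt0.
have := ler_wpM2l (sqr_ge0 t) pair_mean_total; rewrite (mulrA (t ^+ 2)) tt mul1r => hpm.
have tail : expR (- (eps ^+ 2 * beta ^+ 2 / 2)) <= 1 / (eps ^+ 2 * kappa * l) / n%:R.
  have y0 : 0 < eps ^+ 2 * beta ^+ 2 / 2 by rewrite beta2 !mulr_gt0 ?exprn_gt0.
  rewrite expRN; apply: (@le_trans _ _ (eps ^+ 2 * beta ^+ 2 / 2)^-1).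
    by rewrite lef_pV2 ?posrE ?expR_gt0//; have := expR_ge1Dx
      (eps ^+ 2 * beta ^+ 2 / 2); lra.
  rewrite beta2 le_eqVlt; apply/orP; left; apply/eqP; field.
  by rewrite !gt_eqF.
have -> : 2 * t * (t^-1 * (1 - 2 * expR (- (eps ^+ 2 * beta ^+ 2 / 2)))) =
  2 * (1 - 2 * expR (- (eps ^+ 2 * beta ^+ 2 / 2))).
  by rewrite -mulrA mulVKf ?gt_eqF.
rewrite mulNr.
have -> : (K + 1 + 4 / (eps ^+ 2 * kappa * l)) / n%:R = (K + 1) / n%:R + 4 *
  (1 / (eps ^+ 2 * kappa * l) / n%:R).
  by rewrite mulrDl; congr (_ + _); rewrite mul1r mulrA.
lra.
Qed.

End MeanLower.

(** * The limit of a large number of sites *)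

Section Limits.
Context {d : measure_display} {T : measurableType d} {R : realType}.
Variable P : probability T R.
Variable alpha : forall n p : nat, couplings n p -> {RV P >-> R}.
Hypothesis halpha : forall n p : nat, iid_standard_normal (@alpha n p).
Hypothesis hlim : forall p : nat, (2 <= p)%N ->
  cvg (mean_max_product_energy alpha n p @[n --> \oo]).

Lemma mean_max_product_energyE (n p : nat) : (0 < p)%N -> (p <= n)%N ->
  exists2 v, has_mean P (fun w => sphere_max (disorder (@alpha n p) w)) v &
    mean_max_product_energy alpha n p = (Num.sqrt n%:R)^-1 * v.
Proof.
move=> p0 pn; have [v hv] := has_mean_sphere_max (halpha n p) pn p0.
exists v => //; rewrite /mean_max_product_energy -(has_mean_expectation (has_meanZ _ hv)).
by congr (fine 'E_P[_]); apply/funext => w; exact: max_product_energyE.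
Qed.

(** The parameter l / sqrt n = sqrt(2 ln N), with N the size of the net,
    minimises the bound of mean_sphere_max_ub. *)
Lemma limit_ub (p m : nat) : (2 <= p)%N -> (1 < m)%N ->
  limit_product_energy alpha p <=
    net_scale m ^+ p * Num.sqrt (2 * ln #|net_index m|%:R).
Proof.
move=> p2 m1; apply: limr_le; first exact: hlim.
near=> n.
have pn : (p <= n)%N by near: n; exists p.
have n0 : 0 < n%:R :> R by rewrite ltr0n; lia.
have [v hv ->] := mean_max_product_energyE (ltnW p2) pn.
set L := ln _; have L0 : 0 < L.
  by rewrite ln_gt0// ltr1n card_net_index; lia.
set mu := Num.sqrt (2 * L); have mu0 : 0 < mu by rewrite sqrtr_gt0 mulr_gt0.
have mu2 : mu ^+ 2 = 2 * L by rewrite sqr_sqrtr// ltW// mulr_gt0.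
set s := Num.sqrt n%:R; have s0 : 0 < s by rewrite sqrtr_gt0.
have s2 : s ^+ 2 = n%:R by rewrite sqr_sqrtr// ltW.
rewrite ler_pdivrMl//.
apply: le_trans (mean_sphere_max_ub (halpha n p) pn m1 (mulr_gt0 s0 mu0) hv) _.
rewrite -/L mulrCA ler_pM2l; last by rewrite exprn_gt0// (lt_trans ltr01)// net_scale_gt1.
have -> : L = mu ^+ 2 / 2 by rewrite mu2; field.
by rewrite -s2 le_eqVlt; apply/orP; left; apply/eqP; field; rewrite !gt_eqF.
Unshelve. all: by end_near. Qed.

Lemma limit_lb (p m : nat) (kappa eps : R) : (6 <= p)%N -> (0 < m)%N ->
  0 < eps <= 1 -> 0 < kappa <= 1 ->
  64 * ln p%:R * (1 - eps / (18 * m%:R ^+ 2)) ^+ (p - 2) <= 1 ->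
  kappa * ln p%:R * (1 + 2 * eps) + 2 <= (1 - eps) * ln (m%:R ^+ 2) ->
  (1 - eps) * Num.sqrt (2 * kappa * ln p%:R) <= limit_product_energy alpha p.
Proof.
move=> p6 m0 he hk hfar hnear.
set l := ln p%:R in hfar hnear *.
have l0 : 0 < l by rewrite ln_gt0// ltr1n; lia.
set K := 4 * l + expR (4 * p%:R ^+ 2 * l) * (1 + 2 ^+ p * p`!%:R) + 1 + 4 /
  (eps ^+ 2 * kappa * l).
set A := (1 - eps) * Num.sqrt (2 * kappa * l).
have lbn : \forall n \near \oo, A * (1 - K / n%:R) - 4 / Num.sqrt n%:R <=
  mean_max_product_energy alpha n p.
  near=> n.
  have pn2 : (2 * p <= n)%N by near: n; exists (2 * p)%N.
  have pn : (p <= n)%N by lia.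
  have ln4 : 4 * l <= n%:R.
    near: n; exists (Num.truncn (4 * l)).+1 => // n /= hn.
    apply: ltW; apply: lt_le_trans (truncnS_gt _) _.
    by rewrite ler_nat.
  have n0 : 0 < n%:R :> R by rewrite ltr0n; lia.
  have p0 : (0 < p)%N by lia.
  have [v hv ->] := mean_max_product_energyE p0 pn.
  have := mean_sphere_max_lb (halpha n p) m0 p6 pn2 he hk l0 hfar hnear ln4 hv.
  have s0 : 0 < Num.sqrt n%:R :> R by rewrite sqrtr_gt0.
  rewrite -/K [2 * kappa * _ * _]mulrAC sqrtrM; last first.
    by case/andP: hk => /ltW hk _; rewrite !mulr_ge0// ltW.
  rewrite mulrA -/A => h.
  rewrite ler_pdivlMl//; apply: le_trans h.
  rewrite le_eqVlt; apply/orP; left; apply/eqP; field.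
  by rewrite !gt_eqF.
have cvgA : A * (1 - K / n%:R) - 4 / Num.sqrt n%:R @[n --> \oo] --> A.
  have c1 : (n%:R^-1 : R) @[n --> \oo] --> (0 : R).
    by apply/gtr0_cvgV0; [near=> n; rewrite ltr0n; near: n; exists 1%N|exact: cvgr_idn].
  have c2 : ((Num.sqrt n%:R)^-1 : R) @[n --> \oo] --> (0 : R).
    have -> : (fun n => (Num.sqrt n%:R)^-1) = (fun n => Num.sqrt (n%:R^-1 : R)).
      by apply/funext => n; rewrite sqrtrV.
    rewrite -[X in _ --> X]sqrtr0; apply: (cvg_comp _ (@Num.sqrt R)) c1 _.
    exact: sqrt_continuous.
  rewrite -[X in _ --> X]subr0; apply: cvgB.
    rewrite -[X in _ --> X]mulr1; apply: cvgM; first exact: cvg_cst.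
    rewrite -[X in _ --> X]subr0; apply: cvgB; first exact: cvg_cst.
    by rewrite -(mulr0 K); apply: cvgM => //; exact: cvg_cst.
  by rewrite -(mulr0 4); apply: cvgM => //; exact: cvg_cst.
have hc : cvg (mean_max_product_energy alpha n p @[n --> \oo]) by apply: hlim; lia.
have := ler_lim (cvgP _ cvgA) hc lbn.
by rewrite (cvg_lim (@Rhausdorff R) cvgA); apply.
Unshelve. all: by end_near. Qed.

End Limits.

Section MeshBounds.
Context {R : realType}.

Lemma grid_size_exists (x : R) : 1 <= x ->
  exists m : nat, x < m%:R /\ m%:R <= 2 * x.
Proof.
move=> x1; exists (Num.truncn x).+1; split; first exact: truncnS_gt.
by rewrite -natr1; have /andP[h _] := truncn_itv (le_trans ler01 x1); lra.
Qed.

Lemma net_scale_bound (m p : nat) : (1 < m)%N ->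
  net_scale m ^+ p <= expR (2 * (p%:R / m%:R ^+ 2)) :> R.
Proof.
move=> m1.
have m2 : 4 <= m%:R ^+ 2 :> R by rewrite -natrX ler_nat -[4%N]/(2 ^ 2)%N leq_sqr.
set y := (m%:R ^+ 2)^-1 : R.
have y0 : 0 < y by rewrite invr_gt0; lra.
have y1 : y <= 1 / 4 by rewrite div1r lef_pV2 ?posrE//; lra.
have : net_scale m <= expR (2 * y).
  rewrite /net_scale -/y -[leRHS]invrK -expRN.
  rewrite lef_pV2 ?posrE ?expR_gt0//; last by lra.
  have h := expR_ge1Dx (2 * y).
  have e0 := expR_gt0 (- (2 * y)).
  have e1 : expR (2 * y) * expR (- (2 * y)) = 1 by rewrite -expRD subrr expR0.
  have := ler_wpM2r (ltW e0) h; rewrite e1 => h2.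
  have y4 : 0 < 1 + 2 * y by lra.
  rewrite -(ler_pM2l y4); apply: (le_trans h2).
  rewrite -subr_ge0 [leRHS](_ : _ = y * (1 - 2 * y)); last by ring.
  by apply: mulr_ge0; lra.
move=> h; have s0 : 0 < net_scale m :> R by rewrite (lt_trans ltr01)// net_scale_gt1.
have -> : 2 * (p%:R / m%:R ^+ 2) = p%:R * (2 * y) by rewrite /y; ring.
by rewrite expRM_natl lerXn2r ?nnegrE ?expR_ge0// ltW.
Qed.

End MeshBounds.

(** * The limit of many-body interactions *)

Section MeshChoice.
Context {R : realType}.

(** With m^2 of order p^(1 + delta) the dilation is harmless, as p / m^2 tends
    to 0, and the logarithm of the size of the net is (1 + delta) ln p + O(1). *)
Lemma ub_asymptotics (p : nat) (delta : R) : (2 <= p)%N -> 0 < delta <= 1 ->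
  216 / delta ^+ 2 <= ln p%:R ->
  exists2 m, (1 < m)%N & net_scale m ^+ p * Num.sqrt (2 * ln #|net_index m|%:R) <=
    (1 + 3 * delta) * Num.sqrt (2 * ln p%:R) :> R.
Proof.
move=> p2 /andP[d0 d1]; set l := ln p%:R => hl.
have pR : 0 < p%:R :> R by rewrite ltr0n; lia.
have d20 : 0 < delta ^+ 2 by rewrite exprn_gt0.
have d21 : delta ^+ 2 <= 1 by rewrite expr_le1// ltW.
have ld2 : 216 <= l * delta ^+ 2 by rewrite -ler_pdivrMr.
have l216 : 216 <= l.
  by apply: (le_trans ld2); rewrite -[leRHS]mulr1 ler_wpM2l//; nra.
have ld : 216 <= l * delta.
  apply: (le_trans ld2); rewrite ler_wpM2l//; first lra.
  by rewrite expr2 ler_piMl// ltW.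
set x := expR ((1 + delta) / 2 * l).
have x1 : 1 <= x by rewrite -expR0 ler_expR mulr_ge0//; lra.
have [m [xm mx]] := grid_size_exists x1.
have m1 : (1 < m)%N by rewrite -(ltr_nat R); lra.
have mR : 0 < m%:R :> R by lra.
exists m => //.
have xx : x ^+ 2 = p%:R * expR (delta * l).
  by rewrite -[X in X * _]lnK ?posrE// -/l -expRD expr2 -expRD; congr expR; field.
have e1 : p%:R / m%:R ^+ 2 <= (delta * l)^-1.
  have dl : 0 < delta * l by rewrite mulrC; lra.
  rewrite ler_pdivrMr ?exprn_gt0// ler_pdivlMl//.
  apply: (@le_trans _ _ (x ^+ 2)).
    rewrite xx mulrC ler_wpM2l ?ler0n//.
    by have := expR_ge1Dx (delta * l); lra.
  by rewrite lerXn2r ?nnegrE//; lra.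
have h1 : net_scale m ^+ p <= 1 + delta.
  apply: le_trans (net_scale_bound p m1) _.
  apply: (@le_trans _ _ (expR (2 * (delta * l)^-1))).
    by rewrite ler_expR ler_pM2l.
  have dl : 0 < delta * l by rewrite mulrC; lra.
  have h4 : (delta * l)^-1 <= delta / 216.
    rewrite -[leRHS]invrK lef_pV2 ?posrE ?invr_gt0 ?divr_gt0//.
    by rewrite invf_div ler_pdivrMr// mulrAC -expr2 mulrC.
  apply: le_trans (expR_le_1D2x _ _) _.
  - by rewrite mulr_ge0// invr_ge0 ltW.
  - lra.
  - lra.
have cardE : ln #|net_index m|%:R <= (1 + delta) ^+ 2 * l.
  have hc : #|net_index m|%:R <= 216 * x ^+ 2.
    rewrite card_net_index natrM natrX.
    have hm : (2 * m).+1%:R <= 6 * x by rewrite -[(2 * m).+1%:R]natr1 natrM; lra.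
    have : (2 * m).+1%:R ^+ 2 <= (6 * x) ^+ 2 by rewrite lerXn2r ?nnegrE//; lra.
    by rewrite exprMn; lra.
  have C0 : 0 < #|net_index m|%:R :> R by rewrite ltr0n card_net_index muln_gt0 expn_gt0.
  move: (#|net_index m|%:R) C0 hc => C C0 hc.
  have c216 : 0 < 216 :> R by lra.
  have l216' : ln 216 <= 216 :> R by have := expR_ge1Dx (ln 216 : R);
    rewrite lnK ?posrE//; lra.
  move: (216 : R) c216 l216' hc ld => c c216 l216' hc ld.
  have x20 : 0 < x ^+ 2 by rewrite exprn_gt0//; lra.
  apply: (@le_trans _ _ (ln (c * x ^+ 2))).
    by rewrite ler_ln ?posrE// mulr_gt0.
  rewrite lnM ?posrE// xx lnM ?posrE ?expR_gt0// expRK -/l.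
  have : 0 <= delta ^+ 2 * l by rewrite mulr_ge0 ?sqr_ge0//; lra.
  rewrite sqrrD; lra.
have h2 : Num.sqrt (2 * ln #|net_index m|%:R) <= (1 + delta) * Num.sqrt (2 * l).
  rewrite -[1 + delta]ger0_norm; last by lra.
  rewrite -sqrtr_sqr -sqrtrM ?sqr_ge0// ler_wsqrtr//; lra.
apply: le_trans (ler_pM _ _ h1 h2) _.
- by rewrite exprn_ge0// ltW// (lt_trans ltr01)// net_scale_gt1.
- exact: sqrtr_ge0.
rewrite mulrA ler_wpM2r ?sqrtr_ge0//; nra.
Qed.

(** With m^2 of order p^(1 - eps) the grid is still coarse enough to make overlaps
    of far pairs small, (1 - c eps / m^2)^p <= exp(-c eps p^eps), while it has
    enough points to outnumber the near pairs. *)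
Lemma lb_asymptotics (p : nat) (eps : R) : (6 <= p)%N -> 0 < eps <= 1 / 10 ->
  8 * 48 * 48 / eps ^+ 3 <= ln p%:R ->
  exists m, [/\ (0 < m)%N,
    64 * ln p%:R * (1 - eps / (18 * m%:R ^+ 2)) ^+ (p - 2) <= 1 :> R &
    (1 - 5 * eps) * ln p%:R * (1 + 2 * eps) + 2 <= (1 - eps) * ln (m%:R ^+ 2)].
Proof.
move=> p6 /andP[e0 e1]; set l := ln p%:R => hl.
have pR : 0 < p%:R :> R by rewrite ltr0n; lia.
have e30 : 0 < eps ^+ 3 by rewrite exprn_gt0.
have le3 : 8 * 48 * 48 <= l * eps ^+ 3 by rewrite -ler_pdivrMr.
have l0 : 0 < l by rewrite -(pmulr_lgt0 _ e30); lra.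
have e31 : eps ^+ 3 <= eps.
  by rewrite exprS; apply: ler_piMr; [exact: ltW|rewrite expr_le1//; lra].
have le1 : 8 * 48 * 48 <= l * eps by apply: (le_trans le3); rewrite ler_pM2l.
set x := expR ((1 - eps) / 2 * l).
have x1 : 1 <= x by rewrite -expR0 ler_expR mulr_ge0//; lra.
have [m [xm mx]] := grid_size_exists x1.
have mR : 0 < m%:R :> R by lra.
exists m; split; first by rewrite -(ltr_nat R).
- have m20 : 0 < m%:R ^+ 2 :> R by rewrite exprn_gt0.
  have m21 : 1 <= m%:R ^+ 2 :> R by rewrite exprn_ege1//; lra.
  have xx : x ^+ 2 * expR (eps * l) = p%:R.
    by rewrite -[RHS]lnK ?posrE// -/l expr2 -!expRD; congr expR; field.
  set y := eps / (18 * m%:R ^+ 2).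
  have y0 : 0 <= y by rewrite divr_ge0 ?mulr_ge0 ?ltW.
  have m18 : 0 < 18 * m%:R ^+ 2 :> R by lra.
  have y1 : y <= 1.
    rewrite /y (ler_pdivrMr _ _ m18) mul1r.
    by move: (m%:R ^+ 2) m21 => z z1; lra.
  have h1 : (1 - y) ^+ (p - 2) <= expR (- ((p - 2)%:R * y)).
    rewrite -[X in expR X]mulrN expRM_natl lerXn2r ?nnegrE ?expR_ge0//; first lra.
    exact: expR_ge1Dx.
  have h2 : 64 * l <= expR ((p - 2)%:R * y).
    have hz : 64 * l <= (p - 2)%:R * y.
      have p2 : p%:R / 2 <= (p - 2)%:R :> R.
        have p4 : 4 <= p%:R :> R by rewrite ler_nat; apply: leq_trans p6.
        rewrite natrB; last by apply: leq_trans p6.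
        by move: (p%:R : R) p4 => z z4; lra.
      apply: (@le_trans _ _ (p%:R / 2 * y)); last by rewrite ler_wpM2r.
      have m4 : m%:R ^+ 2 <= 4 * x ^+ 2.
        have : m%:R ^+ 2 <= (2 * x) ^+ 2 by rewrite lerXn2r ?nnegrE//; lra.
        by rewrite exprMn; lra.
      have x20 : 0 < x ^+ 2 by rewrite exprn_gt0//; lra.
      have hy : eps / (72 * x ^+ 2) <= y.
        rewrite ler_pM2l// lef_pV2 ?posrE ?mulr_gt0//; lra.
      apply: (@le_trans _ _ (p%:R / 2 * (eps / (72 * x ^+ 2)))); last first.
        by rewrite ler_wpM2l// divr_ge0.
      rewrite -xx (_ : x ^+ 2 * _ / 2 * _ = eps * expR (eps * l) / 144); last first.
        by field; rewrite gt_eqF//; lra.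
      (* exp(eps l) >= (eps l)^2 / 2 suffices once l >= 64 * 288 / eps^3, the constant of
   the hypothesis *)
      have := @expR_ge1Dxn R (eps * l) 1 (mulr_ge0 (ltW e0) (ltW l0)).
      rewrite (_ : (1.+1)`!%:R = 2)// => h3.
      have h4 : eps * ((eps * l) ^+ 2 / 2) <= eps * expR (eps * l).
        by rewrite ler_pM2l//; lra.
      have h5 : 8 * 48 * 48 * l <= eps ^+ 3 * l ^+ 2.
        by rewrite [leRHS](_ : _ = l * eps ^+ 3 * l) ?ler_pM2r//; ring.
      have h6 : eps * ((eps * l) ^+ 2 / 2) = eps ^+ 3 * l ^+ 2 / 2 by field.
      lra.
    by apply: (le_trans hz); have := expR_ge1Dx ((p - 2)%:R * y); lra.
  apply: (@le_trans _ _ (expR ((p - 2)%:R * y) * expR (- ((p - 2)%:R * y)))).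
    by apply: ler_pM => //; [rewrite mulr_ge0// ltW|rewrite exprn_ge0//; lra].
  by rewrite -expRD subrr expR0.
- have h : (1 - eps) * l <= ln (m%:R ^+ 2).
    rewrite -[leLHS]expRK ler_ln ?posrE ?expR_gt0 ?exprn_gt0//.
    rewrite [expR _](_ : _ = x ^+ 2); last by rewrite expr2 -expRD; congr expR; field.
    by rewrite lerXn2r ?nnegrE//; lra.
  have e11 : 0 <= 1 - eps by lra.
  have := ler_wpM2l e11 h.
  have : 0 <= eps ^+ 2 * l by rewrite mulr_ge0 ?sqr_ge0// ltW.
  rewrite expr2; lra.
Qed.

Lemma near_ln_ge (A : R) : \forall p \near \oo, A <= ln p%:R :> R.
Proof.
exists (Num.truncn (expR A)).+1 => // p /= hp.
rewrite -[leLHS]expRK ler_ln ?posrE ?expR_gt0//.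
  apply: ltW; apply: lt_le_trans (truncnS_gt _) _.
  by rewrite ler_nat.
by rewrite ltr0n; apply: leq_trans hp.
Qed.

End MeshChoice.

Unset Implicit Arguments.

Theorem proposition1 (R : realType) (d : measure_display)
    (T : measurableType d) (P : probability T R)
    (alpha : forall n p : nat, couplings n p -> {RV P >-> R})
    (halpha : forall n p : nat, iid_standard_normal (alpha n p))
    (hlim : forall p : nat, (2 <= p)%N ->
       cvg (mean_max_product_energy alpha n p @[n --> \oo])) :
  limit_product_energy alpha p / Num.sqrt (2 * ln p%:R) @[p --> \oo] --> (1 : R).
Proof.
apply/cvgrPdist_le => eta eta0.
pose e := Num.min eta 1 / 10.
have m0 : 0 < Num.min eta 1 by rewrite lt_min eta0 ltr01.
have m1 : Num.min eta 1 <= 1 by rewrite ge_min lexx orbT.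
have me : Num.min eta 1 <= eta by rewrite ge_min lexx.
have e0 : 0 < e by rewrite /e; lra.
have e1 : e <= 1 / 10 by rewrite /e; lra.
have e10 : 10 * e <= eta by rewrite /e; lra.
near=> p.
have p6 : (6 <= p)%N by near: p; exists 6%N.
have l1 : 216 / e ^+ 2 <= ln p%:R by near: p; exact: near_ln_ge.
have l2 : 8 * 48 * 48 / e ^+ 3 <= ln p%:R by near: p; exact: near_ln_ge.
have p2 : (2 <= p)%N by apply: leq_trans p6.
have l0 : 0 < ln p%:R :> R by rewrite ln_gt0// ltr1n.
set s := Num.sqrt (2 * ln p%:R).
have s0 : 0 < s by rewrite sqrtr_gt0 mulr_gt0.
have eb : 0 < e <= 1 by rewrite e0; lra.
have [m hm1 ub] := ub_asymptotics p2 eb l1.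
have {}ub := le_trans (limit_ub halpha hlim p2 hm1) ub.
have eb' : 0 < e <= 1 / 10 by rewrite e0.
have [m' [hm0 hfar hnear]] := lb_asymptotics p6 eb' l2.
(* kappa = 1 - 5 e makes kappa (1 + 2 e) < (1 - e)^2, which leaves room for the
   additive constant in the near-pair condition *)
have kb : 0 < 1 - 5 * e <= 1 by apply/andP; split; lra.
have lb := limit_lb halpha hlim p6 hm0 eb kb hfar hnear.
rewrite mulrAC sqrtrM in lb; last by rewrite mulr_ge0// ltW.
rewrite -/s in ub lb.
have sq : 1 - 5 * e <= Num.sqrt (1 - 5 * e).
  rewrite -[leLHS]ger0_norm; last by lra.
  by rewrite -sqrtr_sqr ler_wsqrtr// expr2 ler_piMl//; lra.
rewrite ler_distlC; apply/andP; split.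
  rewrite ler_pdivlMr//; apply: le_trans lb.
  rewrite mulrA [leRHS]mulrAC ler_pM2r//.
  apply: (@le_trans _ _ ((1 - e) * (1 - 5 * e))); first by nra.
  by rewrite ler_wpM2l//; lra.
rewrite ler_pdivrMr//; apply: (le_trans ub).
by rewrite ler_pM2r//; lra.
Unshelve. all: by end_near. Qed.
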